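(* Let $\tau>0$ and let $(x_n,z_n,y_n)_n$ be generated by the ADMM iterations described in the context. The condition $\max\left\{\frac{1}{\tau\gamma/L_A^2+1},\frac{1}{\delta/\tau+1}\right\}\le 1$ always holds. Let $\omega$ satisfy $$\max\left\{\frac{2}{\tau\gamma/L_A^2+2},\frac{1}{\delta/\tau+1}\right\}\le\omega\le1,$$ and for $N\ge1$ let $T_N=\sum_{n=1}^N\omega^{-(n-1)}=\frac{1-\omega^N}{\omega^{N-1}(1-\omega)}$, $X_N=\frac{1}{T_N}\sum_{n=1}^N\omega^{-(n-1)}x_n$, $Y_N=\frac{1}{T_N}\sum_{n=1}^N\omega^{-(n-1)}y_n$. Then: (i) for all $N\ge1$ and all $(x,y)\in X\times Y$, $$\frac{(1-\omega)^2}{\omega(1-\omega^N)}\frac{1}{2\tau}\|Ax-Ax_N\|^2+\frac{1-\omega}{\omega(1-\omega^N)}\frac{\tau}{2}\|y-y_N\|^2+\ell(X_N;y)-\ell(x;Y_N)\le\frac{1}{T_N}\frac{1}{2\tau}\|Ax-Ax_0\|^2+\frac{1}{T_N}\frac{\tau}{2}\|y-y_0\|^2;$$ (ii) the following converge linearly with rate $\omega$, i.e. there is a constant $C$ independent of $N$ such that each is at most $C\omega^N$: $\|y_N-y^*\|^2$ (dual iterates), $\|Ax_N-Ax^*\|^2$, $\|z_N-z^*\|^2$ with $z^*=Ax^*$, the feasibility error $\|Ax_N-z_N\|^2$, and (ergodic linear convergence) the objective error $f(X_N)-f(x^* )\ge 0$. (iii) The smallest value over $\tau>0$ of the lower bound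 $\max\left\{\frac{2}{\tau\gamma/L_A^2+2},\frac{1}{\delta/\tau+1}\right\}$ for $\omega$, i.e. the best rate, is $$\omega^*=\frac{1}{\sqrt{\gamma\delta/(2L_A^2)}+1}=\frac{1}{\sqrt{1/(2\kappa_f)}+1},\qquad \kappa_f:=\frac{L_A^2}{\gamma\delta},$$ reached when $\tau=\sqrt{2\delta L_A^2/\gamma}$.
   Context: $X,Y$ are finite-dimensional real Hilbert spaces, $A:X\to Y$ is linear with norm $L_A=\|A\|$. $g:X\to\mathbb{R}\cup\{+\infty\}$ and $h:Y\to\mathbb{R}\cup\{+\infty\}$ are proper, convex, lower semicontinuous; $g$ is $\gamma$-strongly convex and the convex conjugate $h^*$ is $\delta$-strongly convex, $\gamma,\delta>0$ (so $h$ is differentiable with $1/\delta$-Lipschitz gradient). The problem is $\min_{x\in X}\{f(x):=g(x)+h(Ax)\}$, assumed to have a solution $x^*$, with $y^*=\nabla h(Ax^* )$, so that, writing $g_A(\xi):=\inf_{x\in X,\,Ax=\xi}g(x)$, the pair $(Ax^*,y^* )$ is a saddle point of $(\xi,y)\mapsto g_A(\xi)+\langle\xi,y\rangle-h^*(y)$. Put $\ell(x;y):=g(x)+\langle Ax,y\rangle-h^*(y)$, so that $f(x)=\sup_{y\in Y}\ell(x;y)$. ADMM iterations, from initial points $x_0\in X$, $z_0\in Y$, $y_0\in Y$: for $n\ge0$, $$x_{n+1}=\arg\min_{x\in X}\Big\{g(x)+\langle Ax,y_n\rangle+\tfrac{1}{2\tau}\|Ax-z_n\|^2\Big\},$$ $$z_{n+1}=\arg\min_{z\in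 Y}\Big\{h(z)-\langle z,y_n\rangle+\tfrac{1}{2\tau}\|Ax_{n+1}-z\|^2\Big\},$$ $$y_{n+1}=y_n+\tfrac1\tau(Ax_{n+1}-z_{n+1}).$$
   Formalization: Part (i) is stated under the extra condition z_0 = A x_0: for unrelated x_0, z_0 it fails (X=Y=ℝ, A=1, g=γx²/2, h=z²/(2δ), x_0=y_0=x=y=0, z_0=1, N=1: right side 0, left side positive). *)

(* Defs.v *)
From HB Require Import structures.
From mathcomp Require Import all_boot all_order all_algebra.
From mathcomp Require Import sesquilinear.
From mathcomp Require Import all_classical all_reals ereal.

Set Implicit Arguments.
Unset Strict Implicit.
Unset Printing Implicit Defensive.

Import Order.TTheory GRing.Theory Num.Theory.

Local Open Scope classical_set_scope.
Local Open Scope ring_scope.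

(* A finite-dimensional real Hilbert space is a V : vectType R together with a
   positive definite symmetric bilinear form d : {dot V for idfun}. *)
Notation innerType V := {dot V for (@idfun _)}.

Definition hnorm (R : realType) (V : vectType R) (d : innerType V) (u : V) : R :=
  Num.sqrt (d u u).

Definition opnorm (R : realType) (X Y : vectType R) (dX : innerType X)
    (dY : innerType Y) (A : {linear X -> Y}) : R :=
  sup [set hnorm dY (A x) | x in [set x | hnorm dX x <= 1]].

Definition proper_fun (R : realType) (V : vectType R) (F : V -> \bar R) : Prop :=
  (forall x, F x != -oo%E) /\ (exists x, F x != +oo%E).

(* Only used for functions that never take the value -oo; recall that
   0 * +oo = 0 in \bar R, so the inequality holds trivially for t = 0 and t = 1. *)
Definition strongly_convex (R : realType) (V : vectType R) (d : innerType V)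
    (mu : R) (F : V -> \bar R) : Prop :=
  forall (x y : V) (t : R), 0 <= t <= 1 ->
    (F (t *: x + (1 - t) *: y)%R
     <= t%:E * F x + (1 - t)%:E * F y
        - (mu / 2 * (t * (1 - t)) * hnorm d (x - y) ^+ 2)%:E)%E.

Definition convex_fun (R : realType) (V : vectType R) (F : V -> \bar R) : Prop :=
  forall (x y : V) (t : R), 0 <= t <= 1 ->
    (F (t *: x + (1 - t) *: y)%R <= t%:E * F x + (1 - t)%:E * F y)%E.

Definition lsc (R : realType) (V : vectType R) (d : innerType V)
    (F : V -> \bar R) : Prop :=
  forall (x : V) (a : R), (a%:E < F x)%E ->
    exists2 r : R, 0 < r & forall y, hnorm d (y - x) < r -> (a%:E < F y)%E.

Definition conjugate (R : realType) (V : vectType R) (d : innerType V)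
    (F : V -> \bar R) (p : V) : \bar R :=
  ereal_sup [set ((d u p)%:E - F u)%E | u in [set: V]].

(* p is the (Frechet) gradient of F at u. *)
Definition is_gradient (R : realType) (V : vectType R) (d : innerType V)
    (F : V -> \bar R) (u p : V) : Prop :=
  F u \is a fin_num /\
  forall e : R, 0 < e -> exists2 r : R, 0 < r &
    forall v, hnorm d v < r ->
      (`|F (u + v)%R - F u - (d p v)%:E| <= (e * hnorm d v)%:E)%E.

Definition is_argmin (R : realType) (V : vectType R) (F : V -> \bar R) (x : V)
  : Prop := forall x', (F x <= F x')%E.

Definition objective (R : realType) (X Y : vectType R) (A : {linear X -> Y})
    (g : X -> \bar R) (h : Y -> \bar R) (x : X) : \bar R :=
  (g x + h (A x))%E.

(* The value is ambiguous (+oo - +oo) only if g x = +oo and h^* y = +oo. *)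
Definition lagr (R : realType) (X Y : vectType R) (dY : innerType Y)
    (A : {linear X -> Y}) (g : X -> \bar R) (h : Y -> \bar R) (x : X) (y : Y)
  : \bar R := (g x + (dY (A x) y)%:E - conjugate dY h y)%E.

Definition is_admm (R : realType) (X Y : vectType R) (dY : innerType Y)
    (A : {linear X -> Y}) (g : X -> \bar R) (h : Y -> \bar R) (tau : R)
    (x_ : nat -> X) (z_ y_ : nat -> Y) : Prop :=
  forall n : nat,
    [/\ is_argmin (fun x => g x + (dY (A x) (y_ n))%:E
          + (1 / (2 * tau) * hnorm dY (A x - z_ n) ^+ 2)%:E)%E (x_ n.+1),
        is_argmin (fun z => h z - (dY z (y_ n))%:E
          + (1 / (2 * tau) * hnorm dY (A (x_ n.+1) - z) ^+ 2)%:E)%E (z_ n.+1)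
      & y_ n.+1 = y_ n + (1 / tau) *: (A (x_ n.+1) - z_ n.+1)].

(* c / (tau gamma / L^2 + c), read as its limit 0 when L = 0
   (tau gamma / L^2 = +oo then, whereas _ / 0 = 0 in a field). *)
Definition primal_ratio (R : realType) (c tau gamma L : R) : R :=
  if L == 0 then 0 else c / (tau * gamma / L ^+ 2 + c).

Definition omega_bound (R : realType) (gamma delta L tau : R) : R :=
  Num.max (primal_ratio 2 tau gamma L) (1 / (delta / tau + 1)).

Definition weight_sum (R : realType) (omega : R) (N : nat) : R :=
  \sum_(1 <= n < N.+1) omega ^- n.-1.

Definition weighted_avg (R : realType) (V : vectType R) (omega : R)
    (u_ : nat -> V) (N : nat) : V :=
  (1 / weight_sum omega N) *: \sum_(1 <= n < N.+1) omega ^- n.-1 *: u_ n.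

(* (1 - omega) / (omega (1 - omega^N)), extended to omega = 1 by its limit. *)
Definition dual_coef (R : realType) (omega : R) (N : nat) : R :=
  if omega == 1 then 1 / N%:R else (1 - omega) / (omega * (1 - omega ^+ N)).

(* (1 - omega)^2 / (omega (1 - omega^N)); its limit at omega = 1 is 0, which is
   also the value given by 0 / 0 = 0. *)
Definition primal_coef (R : realType) (omega : R) (N : nat) : R :=
  (1 - omega) ^+ 2 / (omega * (1 - omega ^+ N)).

(* Main.v *)
Require Import Defs.
From HB Require Import structures.
From mathcomp Require Import all_boot all_order all_algebra.
From mathcomp Require Import sesquilinear.
From mathcomp Require Import all_classical all_reals ereal.
From mathcomp Require Import ring lra.

Set Implicit Arguments.
Unset Strict Implicit.
Unset Printing Implicit Defensive.

Import Order.TTheory GRing.Theory Num.Theory.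

Local Open Scope ring_scope.

(** The multiplier update turns the z-step into the statement that z_n is a
    subgradient of h^* at y_n. Adding this to the optimality condition of the
    x-step shows that, at every (x, y), the energy
      E_n = (1 - omega)/(2 tau) |Ax - Ax_n|^2 + omega/(2 tau) |Ax - z_n|^2
            + tau/2 |y - y_n|^2
    satisfies gap_(n+1) + E_(n+1)/omega <= E_n, where gap_n is
    l(x_n; y) - l(x; y_n) and the two lower bounds on omega are exactly what the
    strong convexity terms can absorb. Telescoping with weights omega^-n and
    Jensen's inequality give (i). At the saddle point all gaps are nonnegative,
    so E_n <= omega^n E_0, which controls y_n and z_n, then
    Ax_n - z_n = tau (y_n - y_(n-1)), then Ax_n. The objective error is at most the
    supremum over y of the gaps between (X_N, y) and (xstar, Y_N); this needs
    h = h^**, obtained from proximal points of h. *)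

(** * Finite-dimensional inner products *)

Lemma dotC (R : realType) (V : vectType R) (d : innerType V) (u v : V) :
  d u v = d v u.
Proof. by rewrite hermC /= expr0 mul1r. Qed.

Lemma dotDl (R : realType) (V : vectType R) (d : innerType V) (u v w : V) :
  d (u + v) w = d u w + d v w.
Proof. exact: linearDl. Qed.

Lemma dotDr (R : realType) (V : vectType R) (d : innerType V) (u v w : V) :
  d w (u + v) = d w u + d w v.
Proof. exact: linearDr. Qed.

Lemma dotNl (R : realType) (V : vectType R) (d : innerType V) (u w : V) :
  d (- u) w = - d u w.
Proof. exact: linearNl. Qed.

Lemma dotNr (R : realType) (V : vectType R) (d : innerType V) (u w : V) :
  d w (- u) = - d w u.
Proof. exact: linearNr. Qed.

Lemma dotZl (R : realType) (V : vectType R) (d : innerType V) a (u w : V) :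
  d (a *: u) w = a * d u w.
Proof. exact: linearZl_LR. Qed.

Lemma dotZr (R : realType) (V : vectType R) (d : innerType V) a (u w : V) :
  d w (a *: u) = a * d w u.
Proof. exact: linearZr_LR. Qed.

Definition dotE := (dotDl, dotDr, dotNl, dotNr, dotZl, dotZr).

Lemma dot_gt0 (R : realType) (V : vectType R) (d : innerType V) (u : V) :
  u != 0 -> 0 < d u u.
Proof. exact: neq0_dnorm_gt0. Qed.

Lemma dot_ge0 (R : realType) (V : vectType R) (d : innerType V) (u : V) :
  0 <= d u u.
Proof.
have [->|/(dot_gt0 d)/ltW//] := eqVneq u 0.
by rewrite linear0l.
Qed.

Lemma hnorm_sqr (R : realType) (V : vectType R) (d : innerType V) (u : V) :
  hnorm d u ^+ 2 = d u u.
Proof. by rewrite sqr_sqrtr ?dot_ge0. Qed.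

Lemma hnorm_ge0 (R : realType) (V : vectType R) (d : innerType V) (u : V) :
  0 <= hnorm d u.
Proof. exact: sqrtr_ge0. Qed.

Lemma hnorm0 (R : realType) (V : vectType R) (d : innerType V) :
  hnorm d 0 = 0.
Proof. by rewrite /hnorm linear0l sqrtr0. Qed.

Lemma hnorm_gt0 (R : realType) (V : vectType R) (d : innerType V) (u : V) :
  u != 0 -> 0 < hnorm d u.
Proof. by move=> u0; rewrite sqrtr_gt0 dot_gt0. Qed.

Lemma hnormZ (R : realType) (V : vectType R) (d : innerType V) a (u : V) :
  hnorm d (a *: u) = `|a| * hnorm d u.
Proof.
by rewrite /hnorm dotZl dotZr mulrA -expr2 sqrtrM ?sqr_ge0// sqrtr_sqr.
Qed.

Lemma hnormN (R : realType) (V : vectType R) (d : innerType V) (u : V) :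
  hnorm d (- u) = hnorm d u.
Proof. by rewrite /hnorm dotNl dotNr opprK. Qed.

Lemma hnormB (R : realType) (V : vectType R) (d : innerType V) (u v : V) :
  hnorm d (u - v) = hnorm d (v - u).
Proof. by rewrite -hnormN opprB. Qed.

(** Cauchy-Schwarz, read off from the nonnegative square of [hnorm d v *: u - hnorm d u *: v]. *)
Lemma dot_le (R : realType) (V : vectType R) (d : innerType V) (u v : V) :
  d u v <= hnorm d u * hnorm d v.
Proof.
have [->|u0] := eqVneq u 0; first by rewrite linear0l mulr_ge0 ?hnorm_ge0.
have [->|v0] := eqVneq v 0; first by rewrite linear0r mulr_ge0 ?hnorm_ge0.
have := dot_ge0 d (hnorm d v *: u - hnorm d u *: v).
rewrite !dotE -!hnorm_sqr (dotC d v u).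
have := hnorm_gt0 d u0; have := hnorm_gt0 d v0.
set a := hnorm d u; set b := hnorm d v; set c := d u v => b0 a0 H.
rewrite -(ler_pM2l (mulr_gt0 a0 b0)); lra.
Qed.

Lemma normr_dot_le (R : realType) (V : vectType R) (d : innerType V) (u v : V) :
  `|d u v| <= hnorm d u * hnorm d v.
Proof. by rewrite ler_norml dot_le lerNl -dotNl -(hnormN d u) dot_le. Qed.

Lemma ler_hnormD (R : realType) (V : vectType R) (d : innerType V) (u v : V) :
  hnorm d (u + v) <= hnorm d u + hnorm d v.
Proof.
rewrite -(@ler_pXn2r _ 2) ?nnegrE ?addr_ge0 ?hnorm_ge0//.
rewrite hnorm_sqr !dotE -!hnorm_sqr (dotC d v u).
by have := dot_le d u v; lra.
Qed.

Lemma hnormD_sqr_le (R : realType) (V : vectType R) (d : innerType V) (u v : V) :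
  hnorm d (u + v) ^+ 2 <= 2 * hnorm d u ^+ 2 + 2 * hnorm d v ^+ 2.
Proof.
have := dot_ge0 d (u - v).
by rewrite !hnorm_sqr !dotE (dotC d v u); lra.
Qed.

Lemma ler_hnorm_sum (R : realType) (V : vectType R) (d : innerType V)
    (I : Type) (r : seq I) (P : pred I) (F : I -> V) :
  hnorm d (\sum_(i <- r | P i) F i) <= \sum_(i <- r | P i) hnorm d (F i).
Proof.
elim/big_ind2 : _ => [|x1 x2 y1 y2 H1 H2|//]; first by rewrite hnorm0.
exact: le_trans (ler_hnormD _ _ _) (lerD H1 H2).
Qed.

(* The operator T v = \sum_i <v, e_i> e_i of a basis e is injective, hence
   invertible; b_i is the inverse image of e_i. *)
Lemma dot_frame (R : realType) (V : vectType R) (d : innerType V) :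
  exists n (e b : 'I_n -> V), forall v, v = \sum_i d v (e i) *: b i.
Proof.
pose e i := (vbasis (fullv : {vspace V}))`_i.
pose T v := \sum_(i < \dim (fullv : {vspace V})) d v (e i) *: e i.
have Tlin : linear T.
  move=> a u v; rewrite /T scaler_sumr -big_split /=; apply: eq_bigr => i _.
  by rewrite !dotE scalerDl scalerA.
pose TM := GRing.isLinear.Build R V V _ T Tlin.
pose TL : {linear V -> V} := HB.pack T TM.
have kerT : lker (linfun TL) == 0%VS.
  apply/lker0P => u v; rewrite !lfunE /= => uv.
  apply/eqP; rewrite -subr_eq0; apply/negPn/negP => /(dot_gt0 d).
  set w := u - v.
  have Tw : T w = 0 by rewrite -[T w]/(TL w) raddfB /= uv subrr.
  suff -> : d w w = 0 by rewrite ltxx.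
  (* Freeness of the basis kills every coordinate [d w (e i)]; expanding one copy of [w] in the
     basis then gives [d w w = 0]. *)
  have we i : (i < \dim (fullv : {vspace V}))%N -> d w (e i) = 0.
    move=> ilt; have /freeP := basis_free (vbasisP (fullv : {vspace V})).
    by move=> /(_ (fun i => d w (e i)) Tw (Ordinal ilt)).
  have /coord_vbasis wE : w \in fullv by exact: memvf.
  rewrite {2}wE linear_sumr big1// => i _.
  by rewrite linearZr_LR /= -/(e i) we ?mulr0.
exists (\dim (fullv : {vspace V})), (fun i => e i),
  (fun i => (linfun TL)^-1%VF (e i)) => v.
rewrite -[LHS](lker0_lfunK kerT) lfunE /= /T linear_sum; apply: eq_bigr => i _.
by rewrite linearZ.
Qed.

(** Expanding [x] in a frame reduces the bound to the finitely many vectors [A (b i)]. The set in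
    [opnorm] is therefore bounded and its [sup] is a true supremum. *)
Lemma linear_bounded (R : realType) (X Y : vectType R) (dX : innerType X)
    (dY : innerType Y) (A : {linear X -> Y}) :
  exists2 M : R, 0 <= M & forall x, hnorm dY (A x) <= M * hnorm dX x.
Proof.
have [n [e [b eb]]] := dot_frame dX.
exists (\sum_i hnorm dX (e i) * hnorm dY (A (b i))).
  by apply: sumr_ge0 => i _; rewrite mulr_ge0 ?hnorm_ge0.
move=> x; rewrite {1}(eb x) linear_sum; apply: le_trans (ler_hnorm_sum _ _ _ _) _.
rewrite mulr_suml; apply: ler_sum => i _.
rewrite linearZ/= hnormZ mulrAC ler_wpM2r ?hnorm_ge0// mulrC.
exact: normr_dot_le.
Qed.

Lemma le_opnorm (R : realType) (X Y : vectType R) (dX : innerType X)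
    (dY : innerType Y) (A : {linear X -> Y}) x :
  hnorm dY (A x) <= opnorm dX dY A * hnorm dX x.
Proof.
have [M M0 AM] := linear_bounded dX dY A.
have [->|x0] := eqVneq x 0; first by rewrite raddf0 !hnorm0 mulr0.
have nx := hnorm_gt0 dX x0.
rewrite -ler_pdivrMr// mulrC -[_^-1]ger0_norm ?invr_ge0 ?(ltW nx)//.
rewrite -hnormZ -linearZ; apply: ub_le_sup.
  exists M => _ [y /= y1 <-]; apply: le_trans (AM y) _.
  by rewrite ler_piMr.
exists ((hnorm dX x)^-1 *: x) => //=.
by rewrite hnormZ ger0_norm ?invr_ge0 ?(ltW nx)// mulVf ?gt_eqF.
Qed.

Lemma opnorm_ge0 (R : realType) (X Y : vectType R) (dX : innerType X)
    (dY : innerType Y) (A : {linear X -> Y}) : 0 <= opnorm dX dY A.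
Proof.
have [M M0 AM] := linear_bounded dX dY A.
apply: ub_le_sup; last by exists 0; rewrite /= ?raddf0 hnorm0 ?ler01.
exists M => _ [y /= y1 <-]; apply: le_trans (AM y) _.
by rewrite ler_piMr.
Qed.

(** The intervals [[a n - r n, a n + r n]] meet pairwise, so the supremum of their left ends lies in
    all of them. *)
Lemma real_nested_limit (R : realType) (a r : nat -> R) :
  (forall n m, a n - a m <= r n + r m) -> exists l, forall n, `|a n - l| <= r n.
Proof.
move=> H; pose S := [set a n - r n | n in [set: nat]]%classic.
have ubS m : ubound S (a m + r m).
  by move=> _ [n _ <-]; have := H n m; lra.
have S0 : (S !=set0)%classic by exists (a 0%N - r 0%N); exists 0%N.
exists (sup S) => n.
have : a n - r n <= sup S by apply: ub_le_sup; [exists (a 0%N + r 0%N)|exists n].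
have : sup S <= a n + r n by apply: ge_sup.
rewrite ler_norml; lra.
Qed.

(** Completeness in quantitative form: nested intervals are applied to each coordinate
    [d (u k) (e i)], and [C] is the price of returning from coordinates to the norm. *)
Lemma hnorm_nested_limit (R : realType) (V : vectType R) (d : innerType V) :
  exists2 C : R, 0 <= C & forall (u : nat -> V) (r : nat -> R),
    (forall n m, hnorm d (u n - u m) <= r n + r m) ->
    exists w, forall n, hnorm d (u n - w) <= C * r n.
Proof.
have [n [e [b eb]]] := dot_frame d.
exists (\sum_i hnorm d (e i) * hnorm d (b i)).
  by apply: sumr_ge0 => i _; rewrite mulr_ge0 ?hnorm_ge0.
move=> u r ur.
have /choice[l lP] (i : 'I_n) :
    exists l, forall k, `|d (u k) (e i) - l| <= r k * hnorm d (e i).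
  apply: (@real_nested_limit _ (fun k => d (u k) (e i))) => k m.
  rewrite -mulrDl; apply: le_trans (ler_wpM2r (hnorm_ge0 d (e i)) (ur k m)).
  by rewrite -dotNl -dotDl dot_le.
exists (\sum_i l i *: b i) => k; rewrite {1}(eb (u k)) -sumrB.
apply: le_trans (ler_hnorm_sum _ _ _ _) _; rewrite mulr_suml.
apply: ler_sum => i _; rewrite -scalerBl hnormZ mulrAC.
by rewrite ler_wpM2r ?hnorm_ge0// mulrC lP.
Qed.

(** * Convex functions and conjugates *)

Lemma first_order_ge0 (R : realFieldType) (a b : R) :
  (forall t, 0 < t <= 1 -> 0 <= t * a + t ^+ 2 * b) -> 0 <= a.
Proof.
move=> H; rewrite leNgt; apply/negP => a0.
have c0 : 0 < `|b| - a by have := normr_ge0 b; lra.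
(* With this [t], a + t |b| equals -a^2 / (|b| - a), which is negative. *)
pose t := - a / (`|b| - a).
have t0 : 0 < t by rewrite divr_gt0// oppr_gt0.
have t1 : t <= 1 by rewrite ler_pdivrMr// mul1r; have := normr_ge0 b; lra.
have := H t; rewrite t0 t1 => /(_ isT).
rewrite expr2 -mulrA -mulrDr pmulr_rge0// leNgt => /negP; apply.
apply: (@le_lt_trans _ _ (a + t * `|b|)).
  by rewrite lerD2l ler_wpM2l ?(ltW t0) ?ler_norm.
have -> : a + t * `|b| = - (a ^+ 2) / (`|b| - a).
  by rewrite /t; field; rewrite gt_eqF.
by rewrite mulNr oppr_lt0 divr_gt0// exprn_even_gt0//= lt_eqF.
Qed.

Lemma vanishing_error_le (R : realFieldType) (a b c : R) : 0 <= c ->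
  (forall e, 0 < e -> a <= b + e * c) -> a <= b.
Proof.
move=> c0 H; apply/ler_addgt0Pr => e e0.
have c1 : 0 < c + 1 by lra.
apply: (le_trans (H _ (divr_gt0 e0 c1))).
by rewrite lerD2l mulrAC ler_pdivrMr// ler_wpM2l ?(ltW e0)//; lra.
Qed.

Lemma lte_fin_between (R : realType) (a : R) (x : \bar R) : (a%:E < x)%E ->
  exists2 b, a < b & (b%:E < x)%E.
Proof.
case: x => [r| |//]; rewrite ?lte_fin => ar.
  by exists ((a + r) / 2); rewrite ?lte_fin; lra.
by exists (a + 1); rewrite ?ltry//; lra.
Qed.

Lemma segmentE (R : realType) (V : vectType R) (p x : V) (t : R) :
  p + t *: (x - p) = t *: x + (1 - t) *: p.
Proof. by rewrite scalerBr scalerBl scale1r addrCA addrC. Qed.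

(** Lets the estimates for strongly convex functions serve for [h], with modulus 0. *)
Lemma convex_strongly0 (R : realType) (V : vectType R) (d : innerType V)
    (F : V -> \bar R) : convex_fun F -> strongly_convex d 0 F.
Proof. by move=> cF x y t t01; rewrite !mul0r sube0 cF. Qed.

Lemma strongly_convex_convex (R : realType) (V : vectType R) (d : innerType V)
    (mu : R) (F : V -> \bar R) : 0 <= mu -> strongly_convex d mu F -> convex_fun F.
Proof.
move=> mu0 sF x y t /andP[t0 t1]; apply: (le_trans (sF _ _ _ _)).
  by rewrite t0.
rewrite leeBlDr// leeDl// lee_fin.
by rewrite !mulr_ge0 ?invr_ge0 ?hnorm_ge0 ?subr_ge0.
Qed.

(* s is the derivative of q at p, so that - s is a subgradient of F at p. *)
Lemma argmin_strongly_convex_ge (R : realType) (V : vectType R)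
    (d : innerType V) (mu : R) (F : V -> \bar R) (q s c : V -> R) p fp :
  strongly_convex d mu F -> F p = fp%:E ->
  (forall v t, q (p + t *: v) = q p + t * s v + t ^+ 2 * c v) ->
  is_argmin (fun x => F x + (q x)%:E)%E p ->
  forall x, ((fp - s (x - p) + mu / 2 * hnorm d (x - p) ^+ 2)%:E <= F x)%E.
Proof.
move=> sF Fp qE pmin x.
case Fx : (F x) => [r| |]; rewrite ?leey//; last first.
  by have := pmin x; rewrite Fx Fp.
rewrite lee_fin.
suff : 0 <= r - (fp - s (x - p) + mu / 2 * hnorm d (x - p) ^+ 2) by lra.
(* Minimality bounds [F] at [p + t *: (x - p)] from below and strong convexity bounds it from above;
   the difference is [t] times the claim plus a term in [t ^+ 2]. *)
apply: (@first_order_ge0 _ _ (c (x - p) + mu / 2 * hnorm d (x - p) ^+ 2)).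
move=> t /andP[t0 t1].
have := sF x p t; rewrite t1 (ltW t0) -segmentE Fx Fp => /(_ isT).
have := pmin (p + t *: (x - p)); rewrite qE Fp.
case: (F _) => [k| |]//=; rewrite -?EFinM -?EFinD -?EFinN ?lee_fin//.
by move=> *; lra.
Qed.

(** * Existence of minimisers *)

Lemma strongly_convex_argmin (R : realType) (V : vectType R) (d : innerType V)
    (mu : R) (F : V -> \bar R) (lb : R) :
  0 < mu -> strongly_convex d mu F -> lsc d F -> proper_fun F ->
  (forall x, (lb%:E <= F x)%E) -> exists p, is_argmin F p.
Proof.
move=> mu0 sF lF [Fny [x0 Fx0]] Flb.
pose S := [set r | exists x, F x = r%:E]%classic.
have S0 : (S !=set0)%classic.
  by move: Fx0 (Fny x0); case E : (F x0) => [k| |]// _ _; exists k, x0.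
have lbS : lbound S lb.
  by move=> r [x Fx]; have := Flb x; rewrite Fx lee_fin.
have Sinf : has_inf S by split=> //; exists lb.
pose I := inf S.
have IF x : (I%:E <= F x)%E.
  case Fx : (F x) => [k| |]; rewrite ?leey//; last by have := Fny x; rewrite Fx.
  by rewrite lee_fin; apply: ge_inf; [exists lb|exists x].
pose eta n : R := n.+1%:R^-1.
have eta0 n : 0 < eta n by rewrite invr_gt0.
have eta1 n : eta n <= 1 by rewrite invf_le1// ler1n.
(* The scale [mu / 4] is such that strong convexity at the midpoint of two approximate minimisers
   gives |u n - u m|^2 <= (eta n)^2 + (eta m)^2. *)
pose eps n := mu / 4 * eta n ^+ 2.
have eps0 n : 0 < eps n by rewrite mulr_gt0 ?exprn_gt0// divr_gt0.
have /choice[u uP] n : exists u, exists2 k, F u = k%:E & k < I + eps n.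
  by have [k [x Fx] kI] := inf_adherent (eps0 n) Sinf; exists x, k.
have [C C0 limV] := hnorm_nested_limit d.
have [|w wP] := limV u eta.
  move=> n m; rewrite -(@ler_pXn2r _ 2)// ?nnegrE ?hnorm_ge0 ?addr_ge0 ?(ltW (eta0 _))//.
  have [k1 Fn k1I] := uP n; have [k2 Fm k2I] := uP m.
  have := sF (u n) (u m) 2^-1; rewrite Fn Fm.
  have half01 : 0 <= (2^-1 : R) <= 1 by rewrite invr_ge0 ler0n invf_le1// ler1n.
  move=> /(_ half01); have := IF (2^-1 *: u n + (1 - 2^-1) *: u m).
  case: (F _) => [k| |]//=; rewrite -?EFinM -?EFinD -?EFinN ?lee_fin//.
  move=> Ik kle; have := eta0 n; have := eta0 m; move: k1I k2I; rewrite /eps.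
  set N := hnorm d _ ^+ 2 in kle * => k1I k2I em en.
  have := mulr_ge0 (ltW mu0) (mulr_ge0 (ltW em) (ltW en)).
  by rewrite -(ler_pM2l mu0); lra.
exists w => x; apply: le_trans (IF x); rewrite leNgt; apply/negP.
move=> /lte_fin_between[a Ia aF].
have [r r0 rP] := lF _ _ aF.
(* The first bound puts [u n] into the neighbourhood of [w] where [F] exceeds [a]; the second makes
   [eps n] smaller than [a - I], against [F (u n) < I + eps n]. *)
pose e := Num.min (r / (C + 1)) ((a - I) / mu).
have C1 : 0 < C + 1 by lra.
have e0 : 0 < e by rewrite lt_min !divr_gt0// subr_gt0.
have [n ne] : exists n, eta n < e.
  exists (Num.truncn (e^-1)).
  rewrite /eta invf_plt ?posrE ?ltr0n//; exact: truncnS_gt.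
move: ne; rewrite lt_min => /andP[]; rewrite !ltr_pdivlMr// => n1 n2.
have [k Fk kI] := uP n.
have := rP (u n); rewrite Fk lte_fin => /(_ _).
have -> : hnorm d (u n - w) < r.
  by apply: le_lt_trans (wP n) _; have := eta0 n; nra.
move=> /(_ isT).
have : eps n <= mu * eta n.
  rewrite /eps; have := eta0 n; have := eta1 n => h1 h0.
  by rewrite -mulrA ler_pM2l// expr2; nra.
lra.
Qed.

Lemma lsc_addr (R : realType) (V : vectType R) (d : innerType V)
    (F : V -> \bar R) (q : V -> R) : lsc d F ->
  (forall x e, 0 < e -> exists2 r, 0 < r &
     forall y, hnorm d (y - x) < r -> q x - e < q y) ->
  lsc d (fun x => F x + (q x)%:E)%E.
Proof.
move=> lF qc x a; rewrite -lteBlDr// -EFinB => /lte_fin_between[b ab bF].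
have [r1 r10 H1] := lF _ _ bF.
have [|r2 r20 H2] := qc x (b - (a - q x)); first by rewrite subr_gt0.
exists (Num.min r1 r2) => [|y]; rewrite lt_min ?r10// => /andP[/H1 bFy /H2 qy].
rewrite -lteBlDr// -EFinB; apply: lt_trans bFy.
by rewrite lte_fin; lra.
Qed.

(** * Conjugates and subgradients *)

Lemma conjugate_ge (R : realType) (V : vectType R) (d : innerType V)
    (F : V -> \bar R) u p : ((d u p)%:E - F u <= conjugate d F p)%E.
Proof. by apply: ereal_sup_ubound; exists u. Qed.

(** Fenchel's equality: the subgradient inequality says that [u] attains the supremum in the
    conjugate. *)
Lemma conjugate_subgradient (R : realType) (V : vectType R) (d : innerType V)
    (F : V -> \bar R) u p fu : F u = fu%:E ->
  (forall z, ((fu + d (z - u) p)%:E <= F z)%E) ->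
  conjugate d F p = (d u p - fu)%:E.
Proof.
move=> Fu sub; apply/eqP; rewrite eq_le; apply/andP; split; last first.
  by rewrite EFinB -Fu conjugate_ge.
apply: ge_ereal_sup => _ [z _ <-].
have := sub z; case: (F z) => [k| |]//=; rewrite ?leNye//.
rewrite !lee_fin !dotE; lra.
Qed.

Lemma strongly_convex_addr (R : realType) (V : vectType R) (d : innerType V)
    (mu : R) (F : V -> \bar R) (q : V -> R) : convex_fun F ->
  (forall x y t, q (t *: x + (1 - t) *: y) =
     t * q x + (1 - t) * q y - mu / 2 * (t * (1 - t)) * hnorm d (x - y) ^+ 2) ->
  strongly_convex d mu (fun x => F x + (q x)%:E)%E.
Proof.
move=> cF qE x y t t01; rewrite !muleDr// ?fin_num_adde_defl// addeACA -[leRHS]addeA.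
by rewrite qE; apply: leeD; [exact: cF|rewrite -!EFinM -!EFinD].
Qed.

(** The exact convexity gap that [strongly_convex_addr] asks for, with modulus [2 * c]. *)
Lemma hnorm_sqr_segment (R : realType) (V : vectType R) (d : innerType V)
    (c t : R) (u x y : V) :
  c * hnorm d (u - (t *: x + (1 - t) *: y)) ^+ 2 =
  t * (c * hnorm d (u - x) ^+ 2) + (1 - t) * (c * hnorm d (u - y) ^+ 2)
  - 2 * c / 2 * (t * (1 - t)) * hnorm d (x - y) ^+ 2.
Proof.
by rewrite !hnorm_sqr !dotE (dotC d x u) (dotC d y u) (dotC d y x); field.
Qed.

(** The second-order expansion that [argmin_strongly_convex_ge] asks for. *)
Lemma hnorm_sqr_line (R : realType) (V : vectType R) (d : innerType V)
    (c t : R) (u p v : V) :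
  c * hnorm d (u - (p + t *: v)) ^+ 2 =
  c * hnorm d (u - p) ^+ 2 + t * (- (2 * c) * d v (u - p))
  + t ^+ 2 * (c * hnorm d v ^+ 2).
Proof.
rewrite !hnorm_sqr !dotE (dotC d v u) (dotC d v p) (dotC d p u); ring.
Qed.

Lemma hnorm_sqr_lsc (R : realType) (V : vectType R) (d : innerType V)
    (c : R) (u x : V) (e : R) : 0 <= c -> 0 < e -> exists2 r, 0 < r &
  forall y, hnorm d (y - x) < r ->
    c * hnorm d (u - x) ^+ 2 - e < c * hnorm d (u - y) ^+ 2.
Proof.
(* By Cauchy-Schwarz the loss is at most [2 * c * hnorm d (u - x) * hnorm d (y - x)]; the added 1
   keeps [D] positive. *)
move=> c0 e0; pose D := 2 * c * hnorm d (u - x) + 1.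
have D0 : 0 < D by have := mulr_ge0 c0 (hnorm_ge0 d (u - x)); rewrite /D; lra.
exists (e / D) => [|y]; first exact: divr_gt0.
rewrite ltr_pdivlMr// /D => yx.
have -> : u - y = (u - x) - (y - x) by rewrite opprB addrA subrK.
have := dot_le d (u - x) (y - x).
have := hnorm_ge0 d (y - x).
move: yx; rewrite [X in _ -> _ -> _ -> _ < _ * X]hnorm_sqr.
move: (u - x) (y - x) => v w; rewrite !dotE -!hnorm_sqr (dotC d w v).
move: (hnorm d v) (hnorm d w) (d v w) => a b k yx b0 /(ler_wpM2l c0) H.
have := mulr_ge0 c0 (sqr_ge0 b); lra.
Qed.

(** * Proximal points and biconjugation *)

Lemma prox_exists (R : realType) (V : vectType R) (d : innerType V)
    (h : V -> \bar R) (b lam : R) (p0 u : V) :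
  proper_fun h -> convex_fun h -> lsc d h -> 0 < lam ->
  (forall z, ((b + d z p0)%:E <= h z)%E) ->
  exists p, is_argmin (fun z => h z + (lam^-1 / 2 * hnorm d (u - z) ^+ 2)%:E)%E p.
Proof.
move=> [hny [z0 hz0]] ch lh lam0 minor.
have li0 : 0 < lam^-1 by rewrite invr_gt0.
(* The lower bound is the minimum of the affine minorant plus the quadratic, attained at
   [z = u - lam *: p0]. *)
apply: (@strongly_convex_argmin _ _ d lam^-1 _
          (b + d u p0 - lam / 2 * hnorm d p0 ^+ 2)) => //.
- apply: strongly_convex_addr => // x y t; rewrite hnorm_sqr_segment; field.
  by rewrite gt_eqF.
- apply: lsc_addr => // x e e0; apply: hnorm_sqr_lsc => //.
  by rewrite divr_ge0 ?ltW.
- split=> [x|]; first by have := hny x; case: (h x).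
  by exists z0; case: (h z0) hz0.
- move=> z; apply: (@le_trans _ _ ((b + d z p0)%:E
      + (lam^-1 / 2 * hnorm d (u - z) ^+ 2)%:E)%E); last exact: leeD.
  rewrite -EFinD lee_fin.
  have := mulr_ge0 (ltW li0) (dot_ge0 d ((u - z) - lam *: p0)).
  have -> : d u p0 = d (u - z) p0 + d z p0 by rewrite !dotE subrK.
  move: (u - z) (d z p0) => v k.
  have -> : lam^-1 * d (v - lam *: p0) (v - lam *: p0) =
      lam^-1 * d v v - 2 * d v p0 + lam * d p0 p0.
    by rewrite !dotE (dotC d p0 v); field; rewrite gt_eqF.
  rewrite !hnorm_sqr; lra.
Qed.

(* Subgradients (u - p) / lam of h at proximal points p of u show that the
   biconjugate of h at u exceeds every a < h u as lam -> 0. *)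
Lemma le_biconjugate (R : realType) (V : vectType R) (d : innerType V)
    (h : V -> \bar R) (b : R) (p0 u : V) (a : R) :
  proper_fun h -> convex_fun h -> lsc d h ->
  (forall z, ((b + d z p0)%:E <= h z)%E) ->
  (forall y k, conjugate d h y = k%:E -> d u y - k <= a) -> (h u <= a%:E)%E.
Proof.
move=> ph ch lh minor dual; rewrite leNgt; apply/negP => /lh[r r0 rP].
pose K := a - b - d u p0; pose P := hnorm d p0.
have P0 : 0 <= P by exact: hnorm_ge0.
have c0 : 0 < `|K| / r + P + 1.
  by have := divr_ge0 (normr_ge0 K) (ltW r0); lra.
(* Small enough that a proximal point at distance D >= r from [u] would have D^2 / lam >= (|K| / r +
   P + 1) D, more than the bound |K| + D P allows. *)
pose lam := r / (`|K| / r + P + 1).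
have lam0 : 0 < lam by exact: divr_gt0.
have [p pmin] := prox_exists u ph ch lh lam0 minor.
have [hp hpE] : exists hp, h p = hp%:E.
  have [hny [z0 hz0]] := ph; have := pmin z0; have := hny p; have := hny z0.
  by case: (h z0) hz0 => //= hz _ _; case: (h p) => [k| |]// _ _; exists k.
pose y := lam^-1 *: (u - p).
have sub z : ((hp + d (z - p) y)%:E <= h z)%E.
  have := argmin_strongly_convex_ge (convex_strongly0 d ch) hpE
    (fun v t => hnorm_sqr_line d (lam^-1 / 2) t u p v) pmin z.
  apply: le_trans; rewrite lee_fin /y dotZr mul0r mul0r addr0.
  by rewrite lerD2l mulNr opprK mulrCA mulfV ?mulr1// pnatr_eq0.
(* By Fenchel's equality at [p], the hypothesis at this [y] reads |u - p|^2 / lam + h p <= a. *)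
have := dual _ _ (conjugate_subgradient hpE sub).
have -> : d u y - (d p y - hp) = lam^-1 * hnorm d (u - p) ^+ 2 + hp.
  rewrite hnorm_sqr -dotZr -/y [d (u - p) y]dotDl dotNl; lra.
move=> le_a; have := minor p; rewrite hpE lee_fin => hp_ge.
have hpa : ~ a < hp.
  by have := mulr_ge0 (ltW (_ : 0 < lam^-1)) (sqr_ge0 (hnorm d (u - p)));
     rewrite invr_gt0 => /(_ lam0); lra.
(* Near [u], lower semicontinuity gives [a < h p], which is excluded; far from [u], the choice of
   [lam] is contradicted. *)
have [near|far] := ltP (hnorm d (p - u)) r.
  by have := rP _ near; rewrite hpE lte_fin.
move: far le_a; rewrite hnormB; set D := hnorm d (u - p) => far.
have D0 : 0 < D by lra.
have dDP : d u p0 <= d p p0 + D * P.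
  by have := dot_le d (u - p) p0; rewrite !dotE -/D -/P; lra.
move=> le_a.
have : lam^-1 * D ^+ 2 <= `|K| + D * P.
  by have := ler_norm K; rewrite {1}/K; lra.
rewrite /lam invf_div -ler_pdivlMr ?exprn_gt0// => H.
have : `|K| + D * P <= (`|K| / r + P) * D ^+ 1.
  rewrite expr1 mulrDl [P * D]mulrC lerD2r mulrAC ler_pdivlMr// ler_wpM2l//.
move=> H2.
have : (`|K| / r + P + 1) / r * D ^+ 2 <= (`|K| / r + P) * D.
  by rewrite -ler_pdivlMr ?exprn_gt0//; apply: le_trans H _;
     rewrite ler_pM2r ?invr_gt0 ?exprn_gt0.
rewrite expr2 mulrA ler_pM2r// mulrAC ler_pdivrMr// => H3.
have := ler_wpM2l (ltW c0) far; lra.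
Qed.

(** Quadratic growth of the conjugate bounds [d u y - k] uniformly in [y], by completing the square,
    so the biconjugate is finite at every [u]. *)
Lemma conjugate_strong_finite (R : realType) (V : vectType R) (d : innerType V)
    (h : V -> \bar R) (b delta k1 : R) (p0 y1 z1 u : V) :
  proper_fun h -> convex_fun h -> lsc d h -> 0 < delta ->
  (forall z, ((b + d z p0)%:E <= h z)%E) ->
  (forall y, ((k1 + d z1 (y - y1) + delta / 2 * hnorm d (y - y1) ^+ 2)%:E
              <= conjugate d h y)%E) ->
  exists hu, h u = hu%:E.
Proof.
move=> ph ch lh delta0 minor strong.
have : (h u <= (d u y1 - k1 + (2 * delta)^-1 * hnorm d (u - z1) ^+ 2)%:E)%E.
  apply: (le_biconjugate ph ch lh minor) => y k kE.
  have := strong y; rewrite kE lee_fin.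
  have d2 : 0 < (2 * delta)^-1 by rewrite invr_gt0 mulr_gt0.
  have := mulr_ge0 (ltW d2) (dot_ge0 d ((u - z1) - delta *: (y - y1))).
  have -> : d u y = d u y1 + d (u - z1) (y - y1) + d z1 (y - y1).
    by rewrite !dotE; lra.
  move: (u - z1) (y - y1) (d u y1) => v w m.
  have -> : (2 * delta)^-1 * d (v - delta *: w) (v - delta *: w) =
      (2 * delta)^-1 * d v v - d v w + delta / 2 * d w w.
    by rewrite !dotE (dotC d w v); field; rewrite gt_eqF.
  rewrite !hnorm_sqr; lra.
have [hny _] := ph; have := hny u.
by case: (h u) => [k| |]// _ _; exists k.
Qed.

(** An infinite value of [h] near [u] would make the left side of the gradient estimate infinite, so
    the estimate can be read in the reals. *)
Lemma gradient_fin (R : realType) (V : vectType R) (d : innerType V)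
    (h : V -> \bar R) (u p : V) (hu e : R) :
  is_gradient d h u p -> h u = hu%:E -> 0 < e ->
  exists2 r, 0 < r & forall v, hnorm d v < r ->
    exists2 k, h (u + v) = k%:E & `|k - hu - d p v| <= e * hnorm d v.
Proof.
move=> [_ grad] huE /grad[r r0 rP]; exists r => // v /rP; rewrite huE.
by case: (h _) => [k| |]//=; exists k.
Qed.

Lemma small_step (R : realType) (V : vectType R) (d : innerType V) (v : V)
    (r : R) : 0 < r -> exists2 t, 0 < t <= 1 & hnorm d (t *: v) < r.
Proof.
move=> r0; have v1 : 0 < hnorm d v + 1 by have := hnorm_ge0 d v; lra.
exists (Num.min 1 (r / (hnorm d v + 1))).
  by rewrite lt_min ltr01 divr_gt0//= ge_min lexx.
rewrite hnormZ ger0_norm ?le_min ?ler01 ?divr_ge0 ?ltW//.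
have : Num.min 1 (r / (hnorm d v + 1)) * (hnorm d v + 1) <= r.
  by rewrite -ler_pdivlMr// ge_min lexx orbT.
have : 0 < Num.min 1 (r / (hnorm d v + 1)) by rewrite lt_min ltr01 divr_gt0.
lra.
Qed.

(** Convexity on the segment from [u] to [z] is compared with the gradient estimate at a small [t];
    after division by [t] the inequality holds up to an arbitrarily small multiple of |z - u|. *)
Lemma gradient_subgradient (R : realType) (V : vectType R) (d : innerType V)
    (h : V -> \bar R) (u p : V) (hu : R) :
  convex_fun h -> is_gradient d h u p -> h u = hu%:E ->
  forall z, (h z != -oo)%E -> ((hu + d (z - u) p)%:E <= h z)%E.
Proof.
move=> ch grad huE z; case hzE : (h z) => [hz| |]//; rewrite ?leey// => _.
rewrite lee_fin; apply: (@vanishing_error_le _ _ _ (hnorm d (z - u))).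
  exact: hnorm_ge0.
move=> e e0; have [r r0 rP] := gradient_fin grad huE e0.
have [t /andP[t0 t1] tr] := small_step d (z - u) r0.
have [k kE] := rP _ tr.
have := ch z u t; rewrite t1 (ltW t0) => /(_ isT).
rewrite -segmentE kE hzE huE -!EFinM -EFinD lee_fin => kle.
rewrite hnormZ (gtr0_norm t0) dotZr (dotC d p) ler_norml => /andP[H _].
rewrite -(ler_pM2l t0); lra.
Qed.

(** Fermat's rule for the sum: minus the adjoint of [A] applied to [p] is a subgradient of [g] at
    [xs]. Differentiability of [h] allows a direct comparison along segments instead of a
    subdifferential sum rule. *)
Lemma composite_argmin_ge (R : realType) (X Y : vectType R) (dY : innerType Y)
    (A : {linear X -> Y}) (g : X -> \bar R) (h : Y -> \bar R) (xs : X) (p : Y)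
    (gs hs : R) :
  convex_fun g -> (forall x, g x != -oo%E) -> is_argmin (objective A g h) xs ->
  is_gradient dY h (A xs) p -> g xs = gs%:E -> h (A xs) = hs%:E ->
  forall x, ((gs - dY (A (x - xs)) p)%:E <= g x)%E.
Proof.
move=> cg gny smin grad gsE hsE x.
have := gny x; case gxE : (g x) => [gx| |]//; rewrite ?leey// => _.
rewrite lee_fin; apply: (@vanishing_error_le _ _ _ (hnorm dY (A (x - xs)))).
  exact: hnorm_ge0.
move=> e e0; have [r r0 rP] := gradient_fin grad hsE e0.
have [t /andP[t0 t1] tr] := small_step dY (A (x - xs)) r0.
have [k kE] := rP _ tr.
have := cg x xs t; rewrite t1 (ltW t0) => /(_ isT).
have := smin (xs + t *: (x - xs)).
rewrite /objective [A (xs + _)]linearD [A (t *: _)]linearZ /= kE gsE hsE gxE.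
rewrite -segmentE.
case: (g (xs + _)) => [m| |]//=; rewrite -!EFinM -!EFinD !lee_fin => le1 le2.
rewrite hnormZ (gtr0_norm t0) dotZr (dotC dY p) ler_norml => /andP[_ H].
rewrite -(ler_pM2l t0); lra.
Qed.

(** * Weighted averages and the energy estimate *)

Lemma weight_sumS (R : realType) (omega : R) (N : nat) :
  weight_sum omega N.+1 = weight_sum omega N + omega ^- N.
Proof. by rewrite /weight_sum big_nat_recr. Qed.

Lemma weight_sum_ge (R : realType) (omega : R) (N : nat) : 0 < omega ->
  omega ^- N <= weight_sum omega N.+1.
Proof.
move=> w0; rewrite weight_sumS lerDr /weight_sum.
by apply: sumr_ge0 => i _; rewrite invr_ge0 exprn_ge0// ltW.
Qed.

Lemma weight_sum_gt0 (R : realType) (omega : R) (N : nat) : 0 < omega ->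
  0 < weight_sum omega N.+1.
Proof.
move=> w0; apply: lt_le_trans (weight_sum_ge N w0).
by rewrite invr_gt0 exprn_gt0.
Qed.

(** Only the last weight [omega ^- N] is kept; this gives the averaged objective its linear rate. *)
Lemma inv_weight_sum_le (R : realType) (omega : R) (N : nat) : 0 < omega ->
  (weight_sum omega N.+1)^-1 <= omega ^+ N.
Proof.
move=> w0; rewrite -[leRHS]invrK lef_pV2 ?weight_sum_ge//.
  by rewrite posrE weight_sum_gt0.
by rewrite posrE invr_gt0 exprn_gt0.
Qed.

Lemma weight_sumE (R : realType) (omega : R) (N : nat) :
  0 < omega -> omega != 1 ->
  weight_sum omega N.+1 = (1 - omega ^+ N.+1) / (omega ^+ N * (1 - omega)).
Proof.
move=> w0 w1; have w1' : 1 - omega != 0 by rewrite subr_eq0 eq_sym.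
have wn n : omega ^+ n != 0 by rewrite expf_neq0// gt_eqF.
elim: N => [|N IH]; rewrite weight_sumS ?IH.
  by rewrite /weight_sum big_geq// expr0 expr1 invr1 mul1r add0r divff.
rewrite [omega ^+ N.+2]exprS [omega ^+ N.+1]exprS; field.
by rewrite w1' wn gt_eqF.
Qed.

Lemma weight_sum1 (R : realType) (N : nat) : weight_sum (1 : R) N = N%:R.
Proof.
elim: N => [|N IH]; first by rewrite /weight_sum big_geq.
by rewrite weight_sumS IH expr1n invr1 -natr1.
Qed.

(** The right side is the factor that telescoping leaves in front of the last energy; it also covers
    [omega = 1], so no later case split arises. *)
Lemma dual_coefE (R : realType) (omega : R) (N : nat) : 0 < omega <= 1 ->
  dual_coef omega N.+1 = omega ^- N.+1 / weight_sum omega N.+1.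
Proof.
move=> /andP[w0 w1]; rewrite /dual_coef; have [->|wn1] := eqVneq omega 1.
  by rewrite weight_sum1 expr1n invr1.
rewrite weight_sumE// invf_div exprS.
have : omega ^+ N != 0 by rewrite expf_neq0// gt_eqF.
have : 1 - omega * omega ^+ N != 0.
  by rewrite -exprS gt_eqF// subr_gt0 exprn_ilt1// ?ltW// lt_neqAle wn1.
by move: (omega ^+ N) => p p1 p0; field; rewrite p1 p0 gt_eqF.
Qed.

Lemma primal_coefE (R : realType) (omega : R) (N : nat) : 0 < omega <= 1 ->
  primal_coef omega N.+1 =
  (1 - omega) * (omega ^- N.+1 / weight_sum omega N.+1).
Proof.
move=> w01; rewrite -dual_coefE// /primal_coef /dual_coef.
by have [->|_] := eqVneq omega 1; rewrite ?subrr ?expr0n ?mul0r// expr2 mulrA.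
Qed.

Lemma weighted_avgS (R : realType) (V : vectType R) (omega : R)
    (u_ : nat -> V) (N : nat) : 0 < omega ->
  let t := weight_sum omega N / weight_sum omega N.+1 in
  weighted_avg omega u_ N.+1 =
  t *: weighted_avg omega u_ N + (1 - t) *: u_ N.+1.
Proof.
move=> w0 t; have T1 := weight_sum_gt0 N w0.
have -> : 1 - t = (1 / weight_sum omega N.+1) * omega ^- N.
  have -> : omega ^- N = weight_sum omega N.+1 - weight_sum omega N.
    by rewrite weight_sumS addrAC subrr add0r.
  by rewrite /t; field; rewrite gt_eqF.
rewrite /weighted_avg big_nat_recr//= scalerDr !scalerA; congr (_ + _).
(* For [N = 0] the preceding average is an empty sum, so its default scaling by [1 / 0] is
   harmless. *)
case: N @t T1 => [|N] t T1; first by rewrite big_geq// !scaler0.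
by rewrite /t mulrA mulr1 mulrAC divff ?gt_eqF ?weight_sum_gt0.
Qed.

(** Induction through [weighted_avgS]. The averages start at index 1, so the values are taken finite
    from there on; [F] may be infinite at the initial point. *)
Lemma weighted_jensen (R : realType) (V : vectType R) (F : V -> \bar R)
    (omega : R) (u_ : nat -> V) (r_ : nat -> R) (N : nat) :
  0 < omega -> convex_fun F -> (forall n, F (u_ n.+1) = (r_ n.+1)%:E) ->
  (F (weighted_avg omega u_ N.+1) <=
   ((\sum_(1 <= n < N.+2) omega ^- n.-1 * r_ n) / weight_sum omega N.+1)%:E)%E.
Proof.
move=> w0 cF Fu; elim: N => [|N IH].
  have -> : weight_sum omega 1 = 1 by rewrite /weight_sum big_nat1 expr0 invr1.
  have -> : weighted_avg omega u_ 1 = u_ 1%N.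
    by rewrite /weighted_avg /weight_sum !big_nat1 expr0 !invr1 mulr1 !scale1r.
  by rewrite Fu big_nat1 expr0 invr1 mul1r mulr1.
have T0 := weight_sum_gt0 N w0; have T1 := weight_sum_gt0 N.+1 w0.
rewrite weighted_avgS//; set t := weight_sum _ N.+1 / _.
have t01 : 0 <= t <= 1.
  apply/andP; split; first by rewrite divr_ge0// ltW.
  rewrite /t ler_pdivrMr// mul1r.
  by rewrite [leRHS]weight_sumS lerDl invr_ge0 exprn_ge0// ltW.
apply: le_trans (cF _ _ _ t01) _; rewrite Fu big_nat_recr//=.
set S := \sum_(_ <= _ < _) _ in IH *.
have /andP[t0 _] := t01.
apply: le_trans (leeD (lee_wpmul2l _ IH) (lexx _)) _; first by rewrite lee_fin.
have -> : omega ^- N.+1 = weight_sum omega N.+2 - weight_sum omega N.+1.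
  by rewrite [weight_sum _ N.+2]weight_sumS addrAC subrr add0r.
rewrite -!EFinM -EFinD lee_fin /t le_eqVlt; apply/orP; left; apply/eqP.
by field; rewrite !gt_eqF.
Qed.

(** The step inequality at [n], multiplied by [omega ^- n], makes consecutive terms in [e]
    cancel. *)
Lemma geometric_telescope (R : realFieldType) (omega : R) (e gap : nat -> R) :
  0 < omega -> (forall n, gap n.+1 + omega^-1 * e n.+1 <= e n) ->
  forall N, \sum_(1 <= n < N.+1) omega ^- n.-1 * gap n + omega ^- N * e N <= e 0%N.
Proof.
move=> w0 step; elim=> [|N IH].
  by rewrite big_geq// add0r expr0 invr1 mul1r.
apply: le_trans IH; rewrite big_nat_recr//= -addrA lerD2l.
have -> : omega ^- N.+1 = omega ^- N * omega^-1 by rewrite exprSr invfM mulrC.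
by rewrite -mulrA -mulrDr ler_wpM2l// invr_ge0 exprn_ge0// ltW.
Qed.

(** The primal weight [1 / (2 * tau)] is shared between [a] and [z] in proportions [1 - omega] and
    [omega]; the two terms merge when [a = z], as for a consistent start. *)
Definition energy (R : realType) (Y : vectType R) (d : innerType Y)
    (omega tau : R) (xi y a z b : Y) : R :=
  (1 - omega) / (2 * tau) * hnorm d (xi - a) ^+ 2
  + omega / (2 * tau) * hnorm d (xi - z) ^+ 2
  + tau / 2 * hnorm d (y - b) ^+ 2.

(* a0, z0, b0 and a1, z1, b1 stand for (A x_n, z_n, y_n) and its successor. *)
Lemma energy_step (R : realType) (Y : vectType R) (d : innerType Y)
    (omega tau m delta : R) (xi y a0 z0 b0 a1 z1 b1 : Y) :
  0 < tau -> 0 < omega <= 1 -> 2 / omega <= 2 + tau * m ->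
  tau / omega <= tau + delta -> b1 = b0 + (1 / tau) *: (a1 - z1) ->
  d (xi - a1) (b0 + (1 / tau) *: (a1 - z0)) - m / 2 * hnorm d (xi - a1) ^+ 2
  - d z1 (y - b1) - delta / 2 * hnorm d (y - b1) ^+ 2 + d a1 y - d xi b1
  + omega^-1 * energy d omega tau xi y a1 z1 b1
  <= energy d omega tau xi y a0 z0 b0.
Proof.
move=> t0 /andP[w0 w1] hm hd b1E.
pose u' := xi - a1; pose z := xi - z0; pose z' := xi - z1; pose v' := y - b1.
have -> : d (xi - a1) (b0 + (1 / tau) *: (a1 - z0)) - m / 2 * hnorm d (xi - a1) ^+ 2
    - d z1 (y - b1) - delta / 2 * hnorm d (y - b1) ^+ 2 + d a1 y - d xi b1 =
  tau^-1 * d u' (z - z') + d (z' - u') v' - m / 2 * d u' u' - delta / 2 * d v' v'.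
  have -> : b0 = b1 - (1 / tau) *: (a1 - z1) by rewrite b1E addrK.
  by rewrite /u' /z /z' /v' !hnorm_sqr !dotE; field; rewrite gt_eqF.
have vE : y - b0 = v' + tau^-1 *: (z' - u').
  have -> : z' - u' = a1 - z1 by rewrite opprB addrC addrA subrK.
  by rewrite /v' b1E div1r opprD addrA subrK.
rewrite /energy vE -/u' -/z -/z' -/v'.
clear vE b1E; clearbody u' z z' v'.
have ti : 0 < tau^-1 by rewrite invr_gt0.
have wi : 0 < omega^-1 by rewrite invr_gt0.
(* Young's inequality, weighted so that the term in [z] is exactly the one available in the previous
   energy. *)
have H1 : tau^-1 * d u' z <= tau^-1 * (omega / 2 * d z z + omega^-1 / 2 * d u' u').
  rewrite ler_pM2l//.
  have := mulr_ge0 (ltW wi) (dot_ge0 d (u' - omega *: z)).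
  have -> : omega^-1 * d (u' - omega *: z) (u' - omega *: z) =
      omega^-1 * d u' u' - 2 * d u' z + omega * d z z.
    by rewrite !dotE (dotC d z u'); field; rewrite gt_eqF.
  lra.
have H2 : 0 <= (1 - omega) / (2 * tau) * hnorm d (xi - a0) ^+ 2.
  apply: mulr_ge0 (sqr_ge0 _); apply: divr_ge0; first by rewrite subr_ge0.
  by rewrite mulr_ge0// ltW.
have H3 : (tau / omega) * d v' v' <= (tau + delta) * d v' v'.
  by rewrite ler_wpM2r ?dot_ge0.
(* The factor [omega^-1] meets |u'|^2 twice, through [H1] and through the weighted new energy; hence
   the constant 2 in the primal part of the rate bound. *)
have H4 : tau^-1 * (2 / omega) * d u' u' <= (2 * tau^-1 + m) * d u' u'.
  have -> : 2 * tau^-1 + m = tau^-1 * (2 + tau * m) by field; rewrite gt_eqF.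
  by rewrite ler_wpM2r ?dot_ge0// ler_wpM2l// ltW.
have -> : omega^-1 * ((1 - omega) / (2 * tau) * hnorm d u' ^+ 2 +
      omega / (2 * tau) * hnorm d z' ^+ 2 + tau / 2 * hnorm d v' ^+ 2) =
    tau^-1 * (omega^-1 - 1) / 2 * d u' u' + tau^-1 / 2 * d z' z'
    + tau / omega / 2 * d v' v'.
  by rewrite !hnorm_sqr; field; rewrite !gt_eqF.
have -> : tau / 2 * hnorm d (v' + tau^-1 *: (z' - u')) ^+ 2 =
    tau / 2 * d v' v' + d (z' - u') v'
    + tau^-1 / 2 * (d z' z' - 2 * d u' z' + d u' u').
  rewrite hnorm_sqr !dotE (dotC d z' u') (dotC d v' z') (dotC d v' u').
  by field; rewrite gt_eqF.
have -> : omega / (2 * tau) * hnorm d z ^+ 2 = tau^-1 * omega / 2 * d z z.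
  by rewrite hnorm_sqr; field; rewrite gt_eqF.
rewrite [d u' (z - z')]dotDr dotNr; lra.
Qed.

(** * ADMM *)

Lemma argmin_fin (R : realType) (V : vectType R) (F : V -> \bar R)
    (q : V -> R) p : proper_fun F ->
  is_argmin (fun x => F x + (q x)%:E)%E p -> exists k, F p = k%:E.
Proof.
move=> [Fny [x0 Fx0]] pmin; have := pmin x0; have := Fny p; have := Fny x0.
by case: (F x0) Fx0 => //= k0 _ _; case: (F p) => [k| |]// _ _; exists k.
Qed.

(** First-order optimality, [s] being the derivative at [p] of the linear and quadratic terms. With
    the old [z] inside, the vector paired with [A x - A p] is in general not the next multiplier. *)
Lemma admm_x_step (R : realType) (X Y : vectType R) (dX : innerType X)
    (dY : innerType Y) (A : {linear X -> Y}) (g : X -> \bar R)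
    (gamma tau : R) (b z : Y) (p : X) :
  proper_fun g -> strongly_convex dX gamma g ->
  is_argmin (fun x => g x + (dY (A x) b)%:E
    + (1 / (2 * tau) * hnorm dY (A x - z) ^+ 2)%:E)%E p ->
  exists2 gp, g p = gp%:E & forall x,
    ((gp - dY (A x - A p) (b + (1 / tau) *: (A p - z))
      + gamma / 2 * hnorm dX (x - p) ^+ 2)%:E <= g x)%E.
Proof.
move=> pg sg pmin.
pose q x := dY (A x) b + 1 / (2 * tau) * hnorm dY (A x - z) ^+ 2.
have pmin' : is_argmin (fun x => g x + (q x)%:E)%E p.
  by move=> x; rewrite !EFinD !addeA; exact: pmin.
have [gp gpE] := argmin_fin pg pmin'; exists gp => // x.
pose s v := dY (A v) (b + (1 / tau) *: (A p - z)).
have -> : dY (A x - A p) (b + (1 / tau) *: (A p - z)) = s (x - p).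
  by rewrite /s [A (x - p)]linearB.
apply: (argmin_strongly_convex_ge sg gpE (q := q)
  (c := fun v => 1 / (2 * tau) * hnorm dY (A v) ^+ 2)) => // v t.
rewrite /q /s ![A (p + _)]linearD ![A (t *: _)]linearZ /= !hnorm_sqr.
rewrite !dotE (dotC dY (A v) (A p)) (dotC dY z) (dotC dY z (A v)).
by rewrite !mul1r invfM; move: tau^-1 => ti; field.
Qed.

(** Here [b + (1 / tau) *: (a - p)] is exactly the updated multiplier, which is thus a subgradient
    of [h] at the new [z]. *)
Lemma admm_z_step (R : realType) (Y : vectType R) (d : innerType Y)
    (h : Y -> \bar R) (tau : R) (b a p : Y) :
  proper_fun h -> convex_fun h ->
  is_argmin (fun z => h z - (d z b)%:E
    + (1 / (2 * tau) * hnorm d (a - z) ^+ 2)%:E)%E p ->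
  exists2 hp, h p = hp%:E & forall z,
    ((hp + d (z - p) (b + (1 / tau) *: (a - p)))%:E <= h z)%E.
Proof.
move=> ph ch pmin.
pose q z := - d z b + 1 / (2 * tau) * hnorm d (a - z) ^+ 2.
have pmin' : is_argmin (fun z => h z + (q z)%:E)%E p.
  by move=> x; rewrite !EFinD !addeA; exact: pmin.
have [hp hpE] := argmin_fin ph pmin'; exists hp => // z.
pose s v := - d v (b + (1 / tau) *: (a - p)).
have -> : hp + d (z - p) (b + (1 / tau) *: (a - p)) =
    hp - s (z - p) + 0 / 2 * hnorm d (z - p) ^+ 2.
  by rewrite /s opprK !mul0r addr0.
apply: (argmin_strongly_convex_ge (convex_strongly0 d ch) hpE (q := q)
  (c := fun v => 1 / (2 * tau) * hnorm d v ^+ 2)) => // v t.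
rewrite /q hnorm_sqr_line /s !dotE !mul1r invfM.
by move: tau^-1 => ti; field.
Qed.

(** Fenchel's equality makes [y] a minimiser of the conjugate minus [d p]; strong convexity then
    adds the quadratic term. *)
Lemma conjugate_strong_ge (R : realType) (Y : vectType R) (d : innerType Y)
    (h : Y -> \bar R) (delta hp : R) (p y : Y) :
  strongly_convex d delta (conjugate d h) -> h p = hp%:E ->
  conjugate d h y = (d p y - hp)%:E ->
  forall v, ((d p y - hp + d p (v - y) + delta / 2 * hnorm d (v - y) ^+ 2)%:E
             <= conjugate d h v)%E.
Proof.
move=> sh hpE cE v.
have -> : d p y - hp + d p (v - y) = d p y - hp - (- d p (v - y)).
  by rewrite opprK.
apply: (argmin_strongly_convex_ge sh cE (q := fun w => - d p w)
  (s := fun w => - d p w) (c := fun=> 0)) => [w t|w]; first by rewrite !dotE; lra.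
have := conjugate_ge d h p w; rewrite hpE cE.
by case: (conjugate d h w) => [k| |]//=; rewrite ?leey// !lee_fin; lra.
Qed.

(** The number [m] is the curvature of [g] seen through [A], namely [gamma / L ^+ 2] when the
    operator norm [L] is nonzero. *)
Lemma gram_curvature (R : realType) (X Y : vectType R) (dX : innerType X)
    (dY : innerType Y) (A : {linear X -> Y}) (gamma delta tau omega : R) :
  0 < gamma -> 0 < delta -> 0 < tau -> 0 < omega ->
  omega_bound gamma delta (opnorm dX dY A) tau <= omega ->
  exists2 m, 2 / omega <= 2 + tau * m &
    forall x, m * hnorm dY (A x) ^+ 2 <= gamma * hnorm dX x ^+ 2.
Proof.
move=> g0 d0 t0 w0; rewrite /omega_bound ge_max => /andP[+ _].
rewrite /primal_ratio; have [L0 _|L0 wb] := eqVneq (opnorm dX dY A) 0.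
  (* When the norm is 0 so is [A], and any [m] passes the second condition; this one satisfies the
     first. *)
  exists (2 / (tau * omega)).
    have -> : tau * (2 / (tau * omega)) = 2 / omega by field; rewrite !gt_eqF.
    by rewrite lerDr.
  move=> x; have := le_opnorm dX dY A x; rewrite L0 mul0r => A0.
  have -> : hnorm dY (A x) = 0 by apply/le_anti; rewrite A0 hnorm_ge0.
  by rewrite expr0n mulr0 mulr_ge0 ?sqr_ge0// ltW.
have Lp : 0 < opnorm dX dY A by rewrite lt_neqAle eq_sym L0 opnorm_ge0.
move: wb; set L := opnorm _ _ _ in L0 Lp * => wb.
exists (gamma / L ^+ 2).
  rewrite ler_pdivrMr// -ler_pdivrMl//; last first.
    by rewrite addr_gt0// mulr_gt0// divr_gt0// exprn_gt0.
  by move: wb; rewrite mulrA addrC mulrC.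
move=> x; rewrite mulrAC ler_pdivrMr ?exprn_gt0// -mulrA ler_pM2l// -exprMn.
by rewrite ler_pXn2r ?nnegrE ?mulr_ge0 ?hnorm_ge0 ?(ltW Lp)// mulrC le_opnorm.
Qed.

Lemma rate_le1 (R : realType) (gamma delta L tau : R) :
  0 < gamma -> 0 < delta -> 0 < tau ->
  Num.max (primal_ratio 1 tau gamma L) (1 / (delta / tau + 1)) <= 1.
Proof.
move=> g0 d0 t0; rewrite ge_max; apply/andP; split; last first.
  have p : 0 < delta / tau by exact: divr_gt0.
  by rewrite ler_pdivrMr ?addr_gt0// mul1r lerDr ltW.
rewrite /primal_ratio; case: eqP => // /eqP L0.
have L2 : 0 < L ^+ 2 by rewrite lt0r sqrf_eq0 L0 sqr_ge0.
have p : 0 < tau * gamma / L ^+ 2 by rewrite divr_gt0// mulr_gt0.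
rewrite ler_pdivrMr ?addr_gt0//. by rewrite mul1r lerDr ltW.
Qed.

(* With p = tau gamma / (2 L^2) and q = delta / tau the bound is
   1 / (min p q + 1), where p q = s^2 does not depend on tau. *)
Lemma optimal_rate (R : realType) (gamma delta L : R) :
  0 < gamma -> 0 < delta -> 0 < L ->
  let kappa := L ^+ 2 / (gamma * delta) in
  let omegastar := 1 / (Num.sqrt (gamma * delta / (2 * L ^+ 2)) + 1) in
  let taustar := Num.sqrt (2 * delta * L ^+ 2 / gamma) in
  [/\ omegastar = 1 / (Num.sqrt (1 / (2 * kappa)) + 1),
      forall t : R, 0 < t -> omegastar <= omega_bound gamma delta L t,
      0 < taustar
    & omega_bound gamma delta L taustar = omegastar].
Proof.
move=> g0 d0 L0 kappa omegastar taustar.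
have L2 : 0 < L ^+ 2 by rewrite exprn_gt0.
pose s := Num.sqrt (gamma * delta / (2 * L ^+ 2)).
have s2 : s ^+ 2 = gamma * delta / (2 * L ^+ 2).
  by rewrite sqr_sqrtr// divr_ge0 ?mulr_ge0 ?ltW.
have s0 : 0 < s by rewrite sqrtr_gt0 divr_gt0 ?mulr_gt0.
have boundE t : 0 < t -> omega_bound gamma delta L t =
    Num.max (1 / (t * gamma / (2 * L ^+ 2) + 1)) (1 / (delta / t + 1)).
  move=> t0; rewrite /omega_bound /primal_ratio gt_eqF//; congr Num.max.
  have p0 : 0 < t * gamma / L ^+ 2 by rewrite divr_gt0 ?mulr_gt0.
  have -> : t * gamma / (2 * L ^+ 2) = (t * gamma / L ^+ 2) / 2.
    by field; rewrite gt_eqF.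
  by move: p0; set r := _ / L ^+ 2 => p0; field; rewrite !gt_eqF//; lra.
(* This value equalises the two ratios, since [q = s] forces [p = s]. *)
have tE : taustar = delta / s.
  apply/eqP; rewrite -(@eqrXn2 _ 2) ?divr_ge0 ?sqrtr_ge0 ?ltW//.
  rewrite sqr_sqrtr ?divr_ge0 ?mulr_ge0 ?ltW// expr_div_n s2; apply/eqP.
  by field; rewrite !gt_eqF.
have t0 : 0 < taustar by rewrite tE divr_gt0.
split => //.
- rewrite /omegastar; congr (1 / (Num.sqrt _ + 1)).
  by rewrite /kappa; field; rewrite !gt_eqF.
- move=> t tp; rewrite boundE// /omegastar -/s le_max; apply/orP.
  have p0 : 0 < t * gamma / (2 * L ^+ 2) by rewrite divr_gt0 ?mulr_gt0.
  have q0 : 0 < delta / t by rewrite divr_gt0.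
  have pq : t * gamma / (2 * L ^+ 2) * (delta / t) = s ^+ 2.
    by rewrite s2; field; rewrite !gt_eqF.
  move: p0 q0 pq; set p := _ / (2 * _); set q := delta / t => p0 q0 pq.
  rewrite !div1r !lef_pV2 ?posrE ?addr_gt0// !lerD2r.
  (* Since [p * q = s ^+ 2], one of [p] and [q] is at most [s]. *)
  by have [|sp] := leP p s; [left|right; nra].
- rewrite boundE// /omegastar -/s tE.
  have -> : delta / s * gamma / (2 * L ^+ 2) = s.
    have -> : delta / s * gamma / (2 * L ^+ 2) = gamma * delta / (2 * L ^+ 2) / s.
      by field; rewrite !gt_eqF.
    by rewrite -s2 expr2 mulfK// gt_eqF.
  have -> : delta / (delta / s) = s by field; rewrite !gt_eqF.
  by rewrite maxxx.
Qed.

(** * Estimates along the ADMM iterates *)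

Section AdmmEstimates.

Variables (R : realType) (X Y : vectType R) (dX : innerType X)
  (dY : innerType Y) (A : {linear X -> Y}) (g : X -> \bar R) (h : Y -> \bar R)
  (gamma delta tau : R) (x_ : nat -> X) (z_ y_ : nat -> Y).

Hypotheses (g_proper : proper_fun g) (h_proper : proper_fun h)
  (h_convex : convex_fun h) (gamma_gt0 : 0 < gamma) (delta_gt0 : 0 < delta)
  (tau_gt0 : 0 < tau) (g_strong : strongly_convex dX gamma g)
  (hconj_strong : strongly_convex dY delta (conjugate dY h))
  (admm : is_admm dY A g h tau x_ z_ y_).

(** True function values from index 1 on, by the certificates below; at index 0 [fine] may return
    its default. *)
Let g_ n : R := fine (g (x_ n)).
Let h_ n : R := fine (h (z_ n)).
Let k_ n : R := fine (conjugate dY h (y_ n)).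

Lemma admm_primal_certificate n : g (x_ n.+1) = (g_ n.+1)%:E /\
  forall x, ((g_ n.+1 - dY (A x - A (x_ n.+1))
                 (y_ n + (1 / tau) *: (A (x_ n.+1) - z_ n))
               + gamma / 2 * hnorm dX (x - x_ n.+1) ^+ 2)%:E <= g x)%E.
Proof.
have [xn _ _] := admm n; have [gp gpE H] := admm_x_step g_proper g_strong xn.
by rewrite /g_ gpE; split.
Qed.

Lemma admm_minorant n : h (z_ n.+1) = (h_ n.+1)%:E /\
  forall z, ((h_ n.+1 + dY (z - z_ n.+1) (y_ n.+1))%:E <= h z)%E.
Proof.
have [_ zn ->] := admm n; have [hp hpE H] := admm_z_step h_proper h_convex zn.
by rewrite /h_ hpE; split.
Qed.

Lemma admm_dual_certificate n : conjugate dY h (y_ n.+1) = (k_ n.+1)%:E /\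
  forall y, ((k_ n.+1 + dY (z_ n.+1) (y - y_ n.+1)
               + delta / 2 * hnorm dY (y - y_ n.+1) ^+ 2)%:E
             <= conjugate dY h y)%E.
Proof.
have [hE H] := admm_minorant n; have kE := conjugate_subgradient hE H.
by rewrite /k_ kE; split=> // y; exact: conjugate_strong_ge.
Qed.

Section Rate.

Variable omega : R.
Hypothesis omega_rate : omega_bound gamma delta (opnorm dX dY A) tau <= omega <= 1.

Lemma rate_gt0 : 0 < omega.
Proof.
have /andP[+ _] := omega_rate; rewrite /omega_bound ge_max => /andP[_].
by apply: lt_le_trans; rewrite divr_gt0// addr_gt0// divr_gt0.
Qed.

Let E x y n := energy dY omega tau (A x) y (A (x_ n)) (z_ n) (y_ n).

(** The difference l(x_n; y) - l(x; y_n) in real numbers, [gx] and [ky] being the values of [g x]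
    and of the conjugate at [y]. *)
Let gap x y gx ky n :=
  (g_ n + dY (A (x_ n)) y - ky) - (gx + dY (A x) (y_ n) - k_ n).

Lemma admm_gap_step x y gx ky n :
  g x = gx%:E -> conjugate dY h y = ky%:E ->
  gap x y gx ky n.+1 + omega^-1 * E x y n.+1 <= E x y n.
Proof.
move=> gxE kyE; have w0 := rate_gt0.
have [_ _ yrec] := admm n.
have [_ /(_ x)] := admm_primal_certificate n; rewrite gxE lee_fin => Hx.
have [_ /(_ y)] := admm_dual_certificate n; rewrite kyE lee_fin => Hy.
have /andP[wb w1] := omega_rate.
have [m hm mA] := gram_curvature gamma_gt0 delta_gt0 tau_gt0 w0 wb.
have /(_ (x - x_ n.+1)) := mA; rewrite [A (x - _)]linearB /= => Hm.
have w01 : 0 < omega <= 1 by rewrite w0.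
have hd : tau / omega <= tau + delta.
  move: wb; rewrite /omega_bound ge_max => /andP[_].
  have -> : 1 / (delta / tau + 1) = tau / (tau + delta).
    by rewrite addrC; field; rewrite !gt_eqF// addr_gt0.
  by rewrite ler_pdivrMr ?addr_gt0// => H; rewrite ler_pdivrMr// mulrC.
have := energy_step dY (A x) y (A (x_ n)) (z_ n) tau_gt0 w01 hm hd yrec.
rewrite -/(E x y n) -/(E x y n.+1) /gap; lra.
Qed.

Lemma admm_gap_sum x y gx ky N :
  g x = gx%:E -> conjugate dY h y = ky%:E ->
  \sum_(1 <= n < N.+1) omega ^- n.-1 * gap x y gx ky n
    + omega ^- N * E x y N <= E x y 0%N.
Proof.
move=> gxE kyE; apply: (geometric_telescope rate_gt0) => n.
exact: admm_gap_step.
Qed.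

Let X_ := weighted_avg omega x_.
Let Y_ := weighted_avg omega y_.

(** The coupling terms are linear in the iterates, so the weights move inside; only the values of
    [g] and of the conjugate remain for Jensen's inequality. *)
Lemma gap_sumE x y gx ky N :
  \sum_(1 <= n < N.+1) omega ^- n.-1 * gap x y gx ky n =
  \sum_(1 <= n < N.+1) omega ^- n.-1 * g_ n
  + \sum_(1 <= n < N.+1) omega ^- n.-1 * k_ n
  + dY (A (\sum_(1 <= n < N.+1) omega ^- n.-1 *: x_ n)) y
  - dY (A x) (\sum_(1 <= n < N.+1) omega ^- n.-1 *: y_ n)
  - (gx + ky) * weight_sum omega N.
Proof.
elim: N => [|N IH].
  by rewrite /weight_sum !big_geq// !linear0r linear0 linear0l; lra.
rewrite weight_sumS !(big_nat_recr N.+1)//= IH linearD linearZ /= !dotE /gap.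
lra.
Qed.

Lemma admm_ergodic_gap N : exists GX KY,
  [/\ g (X_ N.+1) = GX%:E, conjugate dY h (Y_ N.+1) = KY%:E
    & forall x y gx ky, g x = gx%:E -> conjugate dY h y = ky%:E ->
      omega ^- N.+1 / weight_sum omega N.+1 * E x y N.+1
      + ((GX + dY (A (X_ N.+1)) y - ky) - (gx + dY (A x) (Y_ N.+1) - KY))
      <= 1 / weight_sum omega N.+1 * E x y 0%N].
Proof.
have w0 := rate_gt0; have T0 := weight_sum_gt0 N w0.
have := weighted_jensen N w0 (strongly_convex_convex (ltW gamma_gt0) g_strong)
  (fun n => proj1 (admm_primal_certificate n)).
have := weighted_jensen N w0
  (strongly_convex_convex (ltW delta_gt0) hconj_strong)
  (fun n => proj1 (admm_dual_certificate n)).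
have [gny _] := g_proper; rewrite -/X_ -/Y_.
have := gny (X_ N.+1); case: (g _) => [GX| |]// _.
have [_ /(_ (Y_ N.+1))] := admm_dual_certificate N.
case: (conjugate _ _ _) => [KY| |]// _; rewrite !lee_fin => KYle GXle.
exists GX, KY; split=> // x y gx ky gxE kyE.
have := admm_gap_sum N.+1 gxE kyE; rewrite gap_sumE.
move: KYle GXle; rewrite ler_pdivlMr// ler_pdivlMr//.
rewrite /X_ /Y_ /weighted_avg [A (_ *: _)]linearZ /= dotZl dotZr.
set Sg := \sum_(_ <= _ < _) _ * g_ _; set Sk := \sum_(_ <= _ < _) _ * k_ _.
set T := weight_sum _ _ in T0 *; move=> KYle GXle H.
rewrite -(ler_pM2l T0).
set a := dY (A _) y in H *; set b := dY (A x) _ in H *.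
have -> : T * (1 / T * E x y 0) = E x y 0%N by field; rewrite gt_eqF.
have -> : T * (omega ^- N.+1 / T * E x y N.+1
      + (GX + 1 / T * a - ky - (gx + 1 / T * b - KY))) =
    omega ^- N.+1 * E x y N.+1 + GX * T + KY * T + a - b - (gx + ky) * T.
  by move: (omega ^- N.+1) => p; field; rewrite gt_eqF.
lra.
Qed.

Lemma conjugate_neqNy y : conjugate dY h y != -oo%E.
Proof.
by have [_ /(_ y)] := admm_dual_certificate 0; case: (conjugate _ _ _).
Qed.

Lemma admm_ergodic_estimate N x y : z_ 0%N = A (x_ 0%N) ->
  ((primal_coef omega N.+1 * (1 / (2 * tau))
      * hnorm dY (A x - A (x_ N.+1)) ^+ 2)%:E
   + (dual_coef omega N.+1 * (tau / 2) * hnorm dY (y - y_ N.+1) ^+ 2)%:E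
   + (lagr dY A g h (X_ N.+1) y - lagr dY A g h x (Y_ N.+1))
   <= (1 / weight_sum omega N.+1 * (1 / (2 * tau))
         * hnorm dY (A x - A (x_ 0%N)) ^+ 2)%:E
      + (1 / weight_sum omega N.+1 * (tau / 2)
           * hnorm dY (y - y_ 0%N) ^+ 2)%:E)%E.
Proof.
move=> z0E; have w0 := rate_gt0; have /andP[_ w1] := omega_rate.
have w01 : 0 < omega <= 1 by rewrite w0.
have [GX [KY [GXE KYE H]]] := admm_ergodic_gap N.
rewrite /lagr GXE KYE primal_coefE// dual_coefE//.
have [gny _] := g_proper.
move: (gny x) (conjugate_neqNy y).
(* If [g x] or the conjugate at [y] is +oo, the left side is -oo. *)
case gxE : (g x) => [gx| |]//; case kyE : (conjugate _ _ _) => [ky| |]// _ _; rewrite /= ?leNye//.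
rewrite lee_fin.
apply: le_trans (le_trans (H _ _ _ _ gxE kyE) _).
  rewrite lerD2r; set c := omega ^- N.+1 / _.
  have c0 : 0 <= c.
    by rewrite divr_ge0 ?invr_ge0 ?exprn_ge0 ?(ltW w0)// ltW// weight_sum_gt0.
  (* The [z_] part of the final energy is nonnegative and is dropped. *)
  have := mulr_ge0 c0 (mulr_ge0 (divr_ge0 (ltW w0) (mulr_ge0 (ler0n R 2) (ltW tau_gt0)))
    (sqr_ge0 (hnorm dY (A x - z_ N.+1)))).
  rewrite /E /energy; lra.
rewrite /E /energy z0E; lra.
Qed.

(** * Saddle point and linear convergence *)

Hypotheses (g_convex : convex_fun g) (h_lsc : lsc dY h).
Variables (xs : X) (ys : Y).
Hypotheses (xs_sol : is_argmin (objective A g h) xs)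
  (ys_grad : is_gradient dY h (A xs) ys).

Lemma h_minorant z : ((h_ 1 - dY (z_ 1%N) (y_ 1%N) + dY z (y_ 1%N))%:E <= h z)%E.
Proof.
have [_ /(_ z)] := admm_minorant 0; apply: le_trans.
by rewrite lee_fin dotDl dotNl; lra.
Qed.

Lemma h_fin u : h u = (fine (h u))%:E.
Proof.
have [_ H] := admm_dual_certificate 0.
by have [hu ->] :=
  conjugate_strong_finite u h_proper h_convex h_lsc delta_gt0 h_minorant H.
Qed.

Let gs : R := fine (g xs).
Let hs : R := fine (h (A xs)).
Let ks : R := dY (A xs) ys - hs.

(** As [h] is finite everywhere, the objective is finite wherever [g] is, hence at its minimiser. *)
Lemma g_sol_fin : g xs = gs%:E.
Proof.
rewrite /gs; have [gny [x0]] := g_proper.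
have := xs_sol x0; rewrite /objective (h_fin (A xs)) (h_fin (A x0)).
by have := gny xs; have := gny x0; case: (g x0) => //= r _; case: (g xs).
Qed.

Lemma saddle_primal x : ((gs - dY (A (x - xs)) ys)%:E <= g x)%E.
Proof.
have [gny _] := g_proper.
exact: composite_argmin_ge ys_grad g_sol_fin (h_fin _) x.
Qed.

Lemma conjugate_solE : conjugate dY h ys = ks%:E.
Proof.
have [hny _] := h_proper; apply: conjugate_subgradient (h_fin _) _ => z.
exact: gradient_subgradient ys_grad (h_fin _) _ (hny z).
Qed.

Lemma saddle_dual y :
  ((ks + dY (A xs) (y - ys) + delta / 2 * hnorm dY (y - ys) ^+ 2)%:E
   <= conjugate dY h y)%E.
Proof. exact: conjugate_strong_ge hconj_strong (h_fin _) conjugate_solE y. Qed.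

(** The sum of the two saddle inequalities at the iterates. *)
Lemma saddle_gap_ge0 n : 0 <= gap xs ys gs ks n.+1.
Proof.
have [gE _] := admm_primal_certificate n; have [kE _] := admm_dual_certificate n.
have := saddle_primal (x_ n.+1); have := saddle_dual (y_ n.+1).
rewrite gE kE !lee_fin [A (_ - _)]linearB /= !dotE /gap.
have := mulr_ge0 (ltW delta_gt0) (sqr_ge0 (hnorm dY (y_ n.+1 - ys))); lra.
Qed.

Lemma admm_energy_decay N : E xs ys N <= E xs ys 0%N * omega ^+ N.
Proof.
have w0 := rate_gt0.
have := admm_gap_sum N g_sol_fin conjugate_solE.
have : 0 <= \sum_(1 <= n < N.+1) omega ^- n.-1 * gap xs ys gs ks n.
  rewrite big_nat; apply: sumr_ge0 => -[//|n] _.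
  by rewrite mulr_ge0 ?saddle_gap_ge0// invr_ge0 exprn_ge0// ltW.
move=> S0 H; rewrite -ler_pdivrMr ?exprn_gt0// mulrC; lra.
Qed.

Let E0 := E xs ys 0%N.

Lemma dual_decay N : hnorm dY (y_ N - ys) ^+ 2 <= 2 / tau * E0 * omega ^+ N.
Proof.
have w0 := rate_gt0; have /andP[_ w1] := omega_rate.
have := admm_energy_decay N; rewrite -/E0 {1}/E /energy [hnorm _ (ys - _)]hnormB.
have H1 : 0 <= (1 - omega) / (2 * tau) * hnorm dY (A xs - A (x_ N)) ^+ 2.
  apply: mulr_ge0 (sqr_ge0 _); apply: divr_ge0; first by rewrite subr_ge0.
  by rewrite mulr_ge0// ltW.
have H2 : 0 <= omega / (2 * tau) * hnorm dY (A xs - z_ N) ^+ 2.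
  apply: mulr_ge0 (sqr_ge0 _); apply: divr_ge0; first exact: ltW.
  by rewrite mulr_ge0// ltW.
move=> H; have t2 : 0 < tau / 2 by rewrite divr_gt0.
rewrite -(ler_pM2l t2).
have -> : tau / 2 * (2 / tau * E0 * omega ^+ N) = E0 * omega ^+ N.
  by move: (omega ^+ N) => p; field; rewrite gt_eqF.
lra.
Qed.

Lemma split_decay N :
  hnorm dY (z_ N - A xs) ^+ 2 <= 2 * tau / omega * E0 * omega ^+ N.
Proof.
have w0 := rate_gt0; have /andP[_ w1] := omega_rate.
have := admm_energy_decay N; rewrite -/E0 {1}/E /energy [hnorm _ (_ - z_ N)]hnormB.
have H1 : 0 <= (1 - omega) / (2 * tau) * hnorm dY (A xs - A (x_ N)) ^+ 2.
  apply: mulr_ge0 (sqr_ge0 _); apply: divr_ge0; first by rewrite subr_ge0.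
  by rewrite mulr_ge0// ltW.
have H2 : 0 <= tau / 2 * hnorm dY (ys - y_ N) ^+ 2.
  by apply: mulr_ge0 (sqr_ge0 _); rewrite divr_ge0// ltW.
move=> H; have t2 : 0 < omega / (2 * tau) by rewrite divr_gt0 ?mulr_gt0.
rewrite -(ler_pM2l t2).
have -> : omega / (2 * tau) * (2 * tau / omega * E0 * omega ^+ N) = E0 * omega ^+ N.
  by move: (omega ^+ N) => p; field; rewrite !gt_eqF.
lra.
Qed.

(** The residual is [tau] times a multiplier increment, bounded through the distances of both
    multipliers to [ys]; the older one costs the factor [omega^-1]. *)
Lemma feasibility_decay N :
  hnorm dY (A (x_ N.+1) - z_ N.+1) ^+ 2
  <= 4 * tau * (1 + omega^-1) * E0 * omega ^+ N.+1.
Proof.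
have w0 := rate_gt0; have [_ _ yrec] := admm N.
have -> : A (x_ N.+1) - z_ N.+1 = tau *: ((y_ N.+1 - ys) + - (y_ N - ys)).
  rewrite yrec opprB addrA subrK addrC addrA addNr add0r scalerA.
  by rewrite mulrA mulr1 divff ?gt_eqF// scale1r.
rewrite hnormZ exprMn real_normK ?num_real//.
have := hnormD_sqr_le dY (y_ N.+1 - ys) (- (y_ N - ys)); rewrite hnormN.
have := dual_decay N; have := dual_decay N.+1.
have -> : omega ^+ N = omega^-1 * omega ^+ N.+1.
  by rewrite exprS mulKf// gt_eqF.
move: (omega ^+ N.+1) => p H1 H2 H.
have t2 : 0 < tau ^+ 2 by rewrite exprn_gt0.
have -> : 4 * tau * (1 + omega^-1) * E0 * p =
    tau ^+ 2 * (2 * (2 / tau * E0 * p) + 2 * (2 / tau * E0 * (omega^-1 * p))).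
  by field; rewrite !gt_eqF.
rewrite ler_pM2l//; lra.
Qed.

(** The energy weight of [A (x_ N)] vanishes at [omega = 1], so the bound goes through [z_] and the
    residual. *)
Lemma primal_decay N :
  hnorm dY (A (x_ N.+1) - A xs) ^+ 2
  <= (8 * tau * (1 + omega^-1) + 4 * tau / omega) * E0 * omega ^+ N.+1.
Proof.
have := hnormD_sqr_le dY (A (x_ N.+1) - z_ N.+1) (z_ N.+1 - A xs).
rewrite addrA subrK; have := feasibility_decay N; have := split_decay N.+1.
lra.
Qed.

Lemma energy_init_ge0 : 0 <= E0.
Proof.
have := dual_decay 0; rewrite expr0 mulr1 => /(le_trans (sqr_ge0 _)).
by rewrite pmulr_rge0// divr_gt0.
Qed.

Lemma convex_hnorm_affine a :
  convex_fun (fun x => (hnorm dY (A x - a))%:E : \bar R).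
Proof.
move=> x y t /andP[t0 t1]; rewrite -!EFinM -EFinD lee_fin.
have -> : A (t *: x + (1 - t) *: y) - a =
    t *: (A x - a) + (1 - t) *: (A y - a).
  rewrite linearD !linearZ /= !scalerBr addrACA -opprD -scalerDl.
  by rewrite [t + _]addrC subrK scale1r.
apply: le_trans (ler_hnormD _ _ _) _.
by rewrite !hnormZ !ger0_norm// subr_ge0.
Qed.

(** The iterates stay in one ball since [omega ^+ n <= 1], and Jensen's inequality for the norm
    carries this over to the averages. *)
Lemma average_bounded : exists2 M, 0 <= M &
  forall N, hnorm dY (A (X_ N.+1) - A xs) <= M.
Proof.
have w0 := rate_gt0; have /andP[_ w1] := omega_rate.
pose K := (8 * tau * (1 + omega^-1) + 4 * tau / omega) * E0.
have K0 : 0 <= K.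
  apply: mulr_ge0 energy_init_ge0; rewrite addr_ge0//.
    by rewrite !mulr_ge0 ?addr_ge0 ?invr_ge0 ?(ltW w0) ?(ltW tau_gt0).
  by rewrite divr_ge0 ?mulr_ge0 ?(ltW w0) ?(ltW tau_gt0).
exists (Num.sqrt K) => [|N]; first exact: sqrtr_ge0.
have xM n : hnorm dY (A (x_ n.+1) - A xs) <= Num.sqrt K.
  rewrite -(@ler_pXn2r _ 2) ?nnegrE ?hnorm_ge0 ?sqrtr_ge0// (sqr_sqrtr K0).
  apply: le_trans (primal_decay n) _.
  by rewrite -/K ler_piMr// exprn_ile1// ltW.
have := @weighted_jensen _ _ _ _ x_ (fun n => hnorm dY (A (x_ n) - A xs)) N w0
  (@convex_hnorm_affine (A xs)) (fun=> erefl).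
rewrite lee_fin => /le_trans; apply.
rewrite ler_pdivrMr ?weight_sum_gt0// /weight_sum mulr_sumr big_nat [leRHS]big_nat.
apply: ler_sum => -[//|n] _; rewrite mulrC ler_wpM2r//.
by rewrite invr_ge0 exprn_ge0// ltW.
Qed.

(* By strong convexity of h^*, the supremum over y defining f (X_N) is the
   supremum over a ball around ystar whose radius does not depend on N. *)
Lemma objective_decay : exists2 C, 0 <= C & forall N,
  (0 <= objective A g h (X_ N.+1) - objective A g h xs
     <= (C * omega ^+ N.+1)%:E)%E.
Proof.
have w0 := rate_gt0; have /andP[_ w1] := omega_rate.
have [M M0 XM] := average_bounded.
(* Beyond this radius the growth [delta / 2 * hnorm dY (y - ys) ^+ 2] dominates
   [M * hnorm dY (y - ys)]. *)
pose rho := 2 * M / delta.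
have rho0 : 0 <= rho by rewrite divr_ge0 ?mulr_ge0// ltW.
(* Bounds the initial energy at [(xs, y)] for all [y] in the ball. *)
pose B := (1 - omega) / (2 * tau) * hnorm dY (A xs - A (x_ 0%N)) ^+ 2
  + omega / (2 * tau) * hnorm dY (A xs - z_ 0%N) ^+ 2
  + tau / 2 * (rho + hnorm dY (ys - y_ 0%N)) ^+ 2.
have B0 : 0 <= B.
  have tt : 0 <= 2 * tau by rewrite mulr_ge0// ltW.
  rewrite !addr_ge0// mulr_ge0 ?sqr_ge0//; last by rewrite divr_ge0// ltW.
    by rewrite divr_ge0// subr_ge0.
  by rewrite divr_ge0// ltW.
(* The inverse weight sum gives only [omega ^+ N] at index [N.+1]; dividing by [omega] restores the
   exponent. *)
exists (B / omega) => [|N]; first by rewrite divr_ge0// ltW.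
have [GX [KY [GXE KYE H]]] := admm_ergodic_gap N.
have T0 := weight_sum_gt0 N w0.
have := xs_sol (X_ N.+1); rewrite /objective GXE g_sol_fin.
rewrite (h_fin (A (X_ N.+1))) (h_fin (A xs)) -/hs.
set hX := fine _ => ge0; rewrite /= -!EFinD !lee_fin in ge0 *.
rewrite subr_ge0 ge0 /= exprS mulrA divfK ?gt_eqF//.
have near y k : conjugate dY h y = k%:E -> hnorm dY (y - ys) <= rho ->
    dY (A (X_ N.+1)) y - k <= gs + hs - GX + B * omega ^+ N.
  move=> kE yrho; have := H _ _ _ _ g_sol_fin kE.
  have E_ge0 : 0 <= omega ^- N.+1 / weight_sum omega N.+1 * E xs y N.+1.
    rewrite mulr_ge0 ?divr_ge0 ?invr_ge0 ?exprn_ge0 ?(ltW w0) ?(ltW T0)//.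
    have tt : 0 <= 2 * tau by rewrite mulr_ge0// ltW.
    rewrite /E /energy !addr_ge0// mulr_ge0 ?sqr_ge0//; last first.
    - by rewrite divr_ge0// ltW.
    - by rewrite divr_ge0// ltW.
    - by rewrite divr_ge0// subr_ge0.
  have EB : E xs y 0%N <= B.
    rewrite /E /energy lerD2l ler_wpM2l ?divr_ge0 ?(ltW tau_gt0)//.
    rewrite ler_pXn2r ?nnegrE ?hnorm_ge0 ?addr_ge0 ?hnorm_ge0//.
    have -> : y - y_ 0%N = (y - ys) + (ys - y_ 0%N) by rewrite addrA subrK.
    by apply: le_trans (ler_hnormD _ _ _) _; rewrite lerD2r.
  have TB : 1 / weight_sum omega N.+1 * E xs y 0%N <= B * omega ^+ N.
    rewrite div1r [leRHS]mulrC; apply: (@le_trans _ _ ((weight_sum omega N.+1)^-1 * B)).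
      by rewrite ler_wpM2l// invr_ge0 ltW.
    by rewrite ler_wpM2r// inv_weight_sum_le.
  (* Fenchel-Young at [(A xs, Y_ N.+1)] replaces [dY (A xs) (Y_ N.+1) - KY] by its upper bound
     [hs]. *)
  have := conjugate_ge dY h (A xs) (Y_ N.+1).
  rewrite KYE (h_fin (A xs)) -/hs /= lee_fin; lra.
have : (h (A (X_ N.+1)) <= (gs + hs - GX + B * omega ^+ N)%:E)%E.
  apply: (le_biconjugate h_proper h_convex h_lsc h_minorant) => y k kE.
  have [yrho|yrho] := leP (hnorm dY (y - ys)) rho; first exact: near.
  (* For [y] outside the ball the dual value is at most the one at [ys], which lies in the ball. *)
  have := near _ _ conjugate_solE; rewrite subrr hnorm0 => /(_ rho0).
  apply: le_trans; have := saddle_dual y; rewrite kE lee_fin.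
  have := dot_le dY (A (X_ N.+1) - A xs) (y - ys).
  have := ler_wpM2r (hnorm_ge0 dY (y - ys)) (XM N).
  have : M * hnorm dY (y - ys) <= delta / 2 * hnorm dY (y - ys) ^+ 2.
    rewrite expr2 mulrA ler_wpM2r ?hnorm_ge0//.
    have := ltW yrho; rewrite /rho ler_pdivrMr//; lra.
  rewrite !dotE; lra.
rewrite (h_fin (A (X_ N.+1))) -/hX lee_fin; lra.
Qed.

Lemma admm_linear_convergence : exists C, forall N,
  [/\ hnorm dY (y_ N.+1 - ys) ^+ 2 <= C * omega ^+ N.+1,
      hnorm dY (A (x_ N.+1) - A xs) ^+ 2 <= C * omega ^+ N.+1,
      hnorm dY (z_ N.+1 - A xs) ^+ 2 <= C * omega ^+ N.+1,
      hnorm dY (A (x_ N.+1) - z_ N.+1) ^+ 2 <= C * omega ^+ N.+1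
    & (0 <= objective A g h (X_ N.+1) - objective A g h xs
         <= (C * omega ^+ N.+1)%:E)%E].
Proof.
have w0 := rate_gt0; have [C0 C00 obj] := objective_decay.
have e0 := energy_init_ge0; have t0 := ltW tau_gt0.
have wi : 0 <= omega^-1 by rewrite invr_ge0 ltW.
pose C1 := 2 / tau * E0; pose C2 := 2 * tau / omega * E0.
pose C3 := 4 * tau * (1 + omega^-1) * E0.
pose C4 := (8 * tau * (1 + omega^-1) + 4 * tau / omega) * E0.
have C10 : 0 <= C1 by rewrite mulr_ge0// divr_ge0.
have C20 : 0 <= C2 by rewrite !mulr_ge0.
have C30 : 0 <= C3 by rewrite !mulr_ge0// addr_ge0.
have C40 : 0 <= C4 by rewrite mulr_ge0// addr_ge0 ?mulr_ge0// addr_ge0.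
exists (C0 + C1 + C2 + C3 + C4) => N.
have p0 : 0 <= omega ^+ N.+1 by rewrite exprn_ge0// ltW.
split.
- by apply: le_trans (dual_decay N.+1) _; rewrite ler_wpM2r// -/C1; lra.
- by apply: le_trans (primal_decay N) _; rewrite ler_wpM2r// -/C4; lra.
- by apply: le_trans (split_decay N.+1) _; rewrite ler_wpM2r// -/C2; lra.
- by apply: le_trans (feasibility_decay N) _; rewrite ler_wpM2r// -/C3; lra.
have /andP[-> /le_trans] := obj N; apply.
by rewrite lee_fin ler_wpM2r//; lra.
Qed.

End Rate.

End AdmmEstimates.

Theorem mainTheorem4 (R : realType) (X Y : vectType R)
    (dX : innerType X) (dY : innerType Y) (A : {linear X -> Y})
    (g : X -> \bar R) (h : Y -> \bar R) (gamma delta : R)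
    (xstar : X) (ystar : Y)
    (tau : R) (x_ : nat -> X) (z_ y_ : nat -> Y)
    (g_proper : proper_fun g) (g_convex : convex_fun g) (g_lsc : lsc dX g)
    (h_proper : proper_fun h) (h_convex : convex_fun h) (h_lsc : lsc dY h)
    (gamma_gt0 : 0 < gamma) (delta_gt0 : 0 < delta)
    (g_strong : strongly_convex dX gamma g)
    (hconj_strong : strongly_convex dY delta (conjugate dY h))
    (xstar_sol : is_argmin (objective A g h) xstar)
    (ystar_grad : is_gradient dY h (A xstar) ystar)
    (tau_gt0 : 0 < tau)
    (admm : is_admm dY A g h tau x_ z_ y_) :
  let L := opnorm dX dY A in
  let ell := lagr dY A g h in
  let f := objective A g h in
  Num.max (primal_ratio 1 tau gamma L) (1 / (delta / tau + 1)) <= 1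
  /\
  (forall omega : R, omega_bound gamma delta L tau <= omega <= 1 ->
     let T_ := weight_sum omega in
     let X_ := weighted_avg omega x_ in
     let Y_ := weighted_avg omega y_ in
     [/\ (* closed form of T_N *)
         forall N : nat, (0 < N)%N -> omega != 1 ->
           T_ N = (1 - omega ^+ N) / (omega ^+ N.-1 * (1 - omega)),
         (* (i), for a consistent initialisation *)
         z_ 0%N = A (x_ 0%N) ->
         forall N : nat, (0 < N)%N -> forall (x : X) (y : Y),
           ((primal_coef omega N * (1 / (2 * tau))
               * hnorm dY (A x - A (x_ N)) ^+ 2)%:E
            + (dual_coef omega N * (tau / 2) * hnorm dY (y - y_ N) ^+ 2)%:E
            + (ell (X_ N) y - ell x (Y_ N))
            <= (1 / T_ N * (1 / (2 * tau))
                  * hnorm dY (A x - A (x_ 0%N)) ^+ 2)%:E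
               + (1 / T_ N * (tau / 2) * hnorm dY (y - y_ 0%N) ^+ 2)%:E)%E
       & (* (ii) *)
         exists C : R, forall N : nat, (0 < N)%N ->
           [/\ hnorm dY (y_ N - ystar) ^+ 2 <= C * omega ^+ N,
               hnorm dY (A (x_ N) - A xstar) ^+ 2 <= C * omega ^+ N,
               hnorm dY (z_ N - A xstar) ^+ 2 <= C * omega ^+ N,
               hnorm dY (A (x_ N) - z_ N) ^+ 2 <= C * omega ^+ N
             & (0 <= f (X_ N) - f xstar <= (C * omega ^+ N)%:E)%E]])
  /\
  (* (iii) *)
  (L != 0 ->
     let kappa := L ^+ 2 / (gamma * delta) in
     let omegastar := 1 / (Num.sqrt (gamma * delta / (2 * L ^+ 2)) + 1) in
     let taustar := Num.sqrt (2 * delta * L ^+ 2 / gamma) in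
     [/\ omegastar = 1 / (Num.sqrt (1 / (2 * kappa)) + 1),
         forall t : R, 0 < t -> omegastar <= omega_bound gamma delta L t,
         0 < taustar
       & omega_bound gamma delta L taustar = omegastar]).
Proof.
move=> L ell f; split; first exact: rate_le1.
split=> [omega rate T_ X_ Y_|L0 kappa omegastar taustar]; last first.
  apply: optimal_rate => //.
  by rewrite lt_neqAle eq_sym L0 opnorm_ge0.
have w0 := rate_gt0 delta_gt0 tau_gt0 rate.
split=> [[//|N] _ w1|z0E [//|N] _ x y|].
- exact: weight_sumE.
- exact: (admm_ergodic_estimate g_proper h_proper h_convex gamma_gt0 delta_gt0
    tau_gt0 g_strong hconj_strong admm rate).
have [C CP] := admm_linear_convergence g_proper h_proper h_convex gamma_gt0
  delta_gt0 tau_gt0 g_strong hconj_strong admm rate g_convex h_lsc xstar_sol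
  ystar_grad.
by exists C => -[//|N] _; exact: CP.
Qed.
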